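(* For $\lambda>0$ let $\mathcal P_\lambda$ be the homogeneous Poisson point process of rate $\lambda$ in the Clifford torus $T^2\subset\mathbb E^4$, and let $f_3$ be the number of hyperfaces ($3$-faces) of $\mathrm{conv}\,\mathcal P_\lambda$. Then $\mathsf E\, f_3 = O^*(\lambda\ln\lambda)$ as $\lambda\to\infty$.
   Context: The Clifford torus is $T^2=\{(\cos\phi,\sin\phi,\cos\psi,\sin\psi):-\pi<\phi,\psi\le\pi\}\subset\mathbb E^4$, with its natural (locally Euclidean, flat) Borel area measure $mes_2$, $mes_2(T^2)=4\pi^2$. The homogeneous Poisson point process $\mathcal P_\lambda$ of rate $\lambda>0$ is the random point set in $T^2$ such that for every Borel set $A\subset T^2$ the random variable $n(A)=|\mathcal P_\lambda\cap A|$ has the Poisson distribution with parameter $\lambda\, mes_2(A)$ (the standard Poisson point process with intensity measure $\lambda\, mes_2$). A polytope in $\mathbb E^4$ is called generic if it is a simplicial 4-polytope, or a simplex of dimension at most 3, or empty; $\mathrm{conv}\,\mathcal P_\lambda$ is almost surely generic. The $f$-vector $(f_0,f_1,f_2,f_3)$ of a 4-polytope has $f_i$ equal to the number of $i$-faces. By convention the $f$-vector of a 3-dimensional simplex is $(4,6,4,2)$, of a 2-dimensional simplex $(3,3,1,0)$, of a segment $(2,1,0,0)$, of a point $(1,0,0,0)$, and of the empty polytope $(0,0,0,0)$. All $f_i$ refer to the random polytope $\mathrm{conv}\,\mathcal P_\lambda$. For functions $F_1,F_2$ of $\lambda$, $F_1=O^*(F_2)$ means $\limsup_{\lambda\to\infty}\max\left(\left|\frac{F_1}{F_2}\right|,\left|\frac{F_2}{F_1}\right|\right)<\infty$.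 *)

(* Defs.v *)
From HB Require Import structures.
From mathcomp Require Import all_boot all_order all_algebra.
From mathcomp Require Import finmap.
From mathcomp Require Import all_classical all_reals all_analysis.

Set Implicit Arguments.
Unset Strict Implicit.
Unset Printing Implicit Defensive.

Import Order.TTheory GRing.Theory Num.Theory.
Import numFieldNormedType.Exports.

Local Open Scope classical_set_scope.
Local Open Scope ring_scope.

Section Geometry.
Variable R : realType.
Local Notation E4 := 'rV[R]_4.

Definition dot (c x : E4) : R := \sum_(i < 4) c 0 i * x 0 i.

Definition conv_hull (S : set E4) : set E4 :=
  smallest (@convex_set R E4) S.

Definition affine_set (A : set E4) : Prop :=
  forall (x y : E4) (t : R), A x -> A y -> A ((1 - t) *: x + t *: y).

Definition affine_hull (S : set E4) : set E4 := smallest affine_set S.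

(* The empty set has no dimension in this sense. *)
Definition has_affine_dim (k : nat) (S : set E4) : Prop :=
  exists (x0 : E4) (U : {vspace E4}),
    \dim U = k /\ affine_hull S = [set x | x - x0 \in U].

(* [c = 0] is allowed, so [K] itself (and the empty set) are faces. *)
Definition is_face (K F : set E4) : Prop :=
  exists (c : E4) (b : R), (forall x, K x -> dot c x <= b) /\
    F = K `&` [set x | dot c x = b].

Definition faces (k : nat) (K : set E4) : set (set E4) :=
  [set F | is_face K F /\ has_affine_dim k F].

Definition is_simplex (k : nat) (K : set E4) : Prop :=
  exists S : {fset E4}, [/\ (#|` S|)%fset = k.+1, has_affine_dim k [set` S]
    & K = conv_hull [set` S]].

(* The last entry of the f-vector: the number of 3-faces of a 4-polytope, with
   the convention that it is 2 for a 3-simplex and 0 for simplices of smaller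
   dimension and for the empty polytope. The remaining (non-generic) polytopes,
   of dimension 2 or 3, get the default value 0. *)
Definition f3 (K : set E4) : nat :=
  if `[< has_affine_dim 4 K >] then #|` fset_set (faces 3 K)|%fset
  else if `[< is_simplex 3 K >] then 2%N
  else 0%N.

Definition torus_point (u : R * R) : E4 :=
  \row_(i < 4) [:: cos u.1; sin u.1; cos u.2; sin u.2]`_i.

Definition param_domain : set (R * R) := `]- pi, pi] `*` `]- pi, pi].

Definition clifford_torus : set E4 := torus_point @` param_domain.

Definition borel (A : set E4) : Prop := <<s [set U : set E4 | open U] >> A.

(* [torus_point] is a locally isometric bijection from [param_domain] onto the
   torus, so area is the image of the Lebesgue measure of the plane. *)
Definition mes2 (A : set E4) : \bar R :=
  (lebesgue_measure \x lebesgue_measure)%E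
    (param_domain `&` torus_point @^-1` A).

End Geometry.

Section PointProcess.
Context {R : realType} {d : measure_display} {Omega : measurableType d}.
Local Notation E4 := 'rV[R]_4.

Definition num_points (X : Omega -> set E4) (A : set E4) (w : Omega) : nat :=
  #|` fset_set (X w `&` A)|%fset.

Definition torus_borel (A : set E4) : Prop :=
  borel A /\ A `<=` @clifford_torus R.

(* The second argument of the library's [poisson_prob] is unused; for rate 0
   [poisson_prob] is the Dirac mass at 0. *)
Definition poisson_process (P : probability Omega R) (rate : R)
    (X : Omega -> set E4) : Prop :=
  [/\ forall w, finite_set (X w) /\ X w `<=` @clifford_torus R,
      forall A, torus_borel A -> measurable_fun setT (num_points X A),
      forall A, torus_borel A -> forall U : set nat,
        P (num_points X A @^-1` U) =
        poisson_prob (rate * fine (mes2 A)) 0 U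
    & forall (m : nat) (A : 'I_m -> set E4),
        (forall i, torus_borel (A i)) -> trivIset setT A ->
        forall k : 'I_m -> nat,
        P (\bigcap_i [set w | num_points X (A i) w = k i]) =
        (\prod_(i < m) P [set w | num_points X (A i) w = k i])%E].

End PointProcess.

(* The quotients are taken in the extended reals, where [x / 0 = +oo] for
   [0 < x], so that [F1] vanishing or being infinite near [+oo] is excluded. *)
Definition Ostar {R : realType} (F1 F2 : R -> \bar R) : Prop :=
  (limf_esup (fun l => maxe `|F1 l / F2 l| `|F2 l / F1 l|) +oo%R < +oo)%E.

(* Main.v *)
Require Import Defs.
From HB Require Import structures.
From mathcomp Require Import all_boot all_order all_algebra.
From mathcomp Require Import finmap.
From mathcomp Require Import all_classical all_reals all_analysis.
From mathcomp Require Import measurable_realfun.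
From mathcomp Require Import ring lra zify.

Import Order.TTheory GRing.Theory Num.Theory.
Import numFieldNormedType.Exports.

(* A hyperplane cuts the torus in a cap
     A (1 - cos (x - x0)) + B (1 - cos (y - y0)) <= h,
   which contains a rectangle with the same center and at least half the dimensions of
   its bounding box. If the hyperplane supports a facet, the rectangle contains no
   point of the process, so that a dyadic cell of comparable dimensions is empty
   and the facet is spanned by four points of its enlargement. The number of
   facets charged to a cell thus has expectation [O(exp (- mu / 2))], where [mu] is
   the mean number of points of the cell, and summing over all cells with
   [mu >~ 1] gives [O(lambda)] for each of the [O(ln lambda)] aspect ratios.
   Conversely, for each of the [~ ln lambda] dyadic aspect ratios there are
   [~ lambda] disjoint boxes of area [~ 1 / lambda]; with a probability bounded
   below the points of the process in a box are four points near the tips of an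
   ellipse and one point outside of it. The hyperplane through the four points
   is then close to the one that cuts out the ellipse, so it supports a facet, and
   this facet determines the box and the aspect ratio. *)

(** A facet is determined by four tight points, so a cell receives at most [n ^ 4] facets, where [n]
    counts the points of its enlargement. Emptiness of the cell and [n] are dependent; but when the
    cell is empty, [n] only counts points outside of it, and these are independent of the emptiness.
    Since [n ^ 4 <= C * t ^ n] with [t] as close to 1 as desired, the Poisson generating function
    makes the enlargement, up to 729 times as large, cost only half of the exponent gained by
    emptiness. Caps may be arbitrarily thin. Subdivision therefore stops at the total level [L] with
    [2 ^ L] comparable to the rate: thinner caps are charged to cells of that level, whose mean is
    bounded. A shape of level [m = i + i'] has [2 ^ m] cells, each contributing [O(2 ^ m / rate)],
    and the geometric sums are dominated by the [L + 1] shapes of level [L]. In the lower bound,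
    dividing sine and versine of each angle by their values at the half-widths makes the four tips
    look alike for all aspect ratios: the hyperplane solves a 4 by 4 system close to a fixed one. *)

Local Open Scope classical_set_scope.
Local Open Scope ring_scope.

(** * Faces of convex hulls *)

Section ConvexGeometry.
Set Implicit Arguments. Unset Strict Implicit.
Context {R : realType}.
Local Notation E4 := 'rV[R]_4.
Implicit Types (S A K F : set E4) (c x y p : E4).

Lemma dotD c x y : dot c (x + y) = dot c x + dot c y.
Proof. by rewrite /dot -big_split; apply: eq_bigr => i _; rewrite mxE mulrDr. Qed.

Lemma dotZ c t x : dot c (t *: x) = t * dot c x.
Proof. by rewrite /dot mulr_sumr; apply: eq_bigr => i _; rewrite mxE mulrCA. Qed.

Lemma dotB c x y : dot c (x - y) = dot c x - dot c y.
Proof. by rewrite dotD -scaleN1r dotZ mulN1r. Qed.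

Lemma dot0l x : dot 0 x = 0.
Proof. by rewrite /dot big1// => i _; rewrite mxE mul0r. Qed.

Lemma conv_hull_convex S : @convex_set R E4 (conv_hull S).
Proof.
move=> x y t /set_mem xC /set_mem yC; apply/mem_set => C [cC SC].
by apply/set_mem/cC; apply/mem_set; [exact: xC|exact: yC].
Qed.

Lemma sub_conv_hull S : S `<=` conv_hull S.
Proof. by move=> x Sx C [_]; exact. Qed.

Lemma conv_hull_min S A : @convex_set R E4 A -> S `<=` A -> conv_hull S `<=` A.
Proof. by move=> cA SA x; apply. Qed.

Lemma conv_hullS S A : S `<=` A -> conv_hull S `<=` conv_hull A.
Proof.
move=> SA; apply: conv_hull_min; first exact: conv_hull_convex.
exact: (subset_trans SA (@sub_conv_hull A)).
Qed.

Lemma convex_setP A : @convex_set R E4 A <->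
  forall x y t, 0 < t -> t < 1 -> A x -> A y -> A (t *: x + (1 - t) *: y).
Proof.
rewrite convex_setW; split => [cA x y t t0 t1 Ax Ay|cA x y /set_mem Ax /set_mem Ay t t0 t1].
  have := cA x y (mem_set Ax) (mem_set Ay) (Itv01 (ltW t0) (ltW t1)) t0 t1.
  by move/set_mem.
by apply/mem_set; exact: cA.
Qed.

Lemma conv_hull_dot_le S c b : (forall x, S x -> dot c x <= b) ->
  forall x, conv_hull S x -> dot c x <= b.
Proof.
move=> Sb; apply: (@conv_hull_min S [set x | dot c x <= b]) => //.
apply/convex_setP => x y t t0 t1 /= xb yb; rewrite dotD !dotZ.
have := ler_wpM2l (ltW t0) xb.
have : (1 - t) * dot c y <= (1 - t) * b by rewrite ler_wpM2l// subr_ge0 ltW.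
lra.
Qed.

(* The points of [conv_hull S] off the supporting hyperplane, together with the
   convex hull of the tight points, already form a convex set. *)
Lemma face_conv_hull S c b : (forall x, S x -> dot c x <= b) ->
  conv_hull S `&` [set x | dot c x = b] = conv_hull (S `&` [set x | dot c x = b]).
Proof.
move=> Sb; apply/seteqP; split; last first.
  move=> x xT; split; first by apply: conv_hullS xT => y [].
  move: x xT; apply: conv_hull_min => [|y []//].
  apply/convex_setP => x y t _ _ /= xb yb; rewrite dotD !dotZ xb yb; ring.
pose T := conv_hull (S `&` [set x | dot c x = b]).
have Tb x : T x -> dot c x = b.
  move: x; apply: conv_hull_min => [|y []//].
  apply/convex_setP => x y t _ _ /= xb yb; rewrite dotD !dotZ xb yb; ring.
suff H : conv_hull S `<=` [set x | dot c x < b] `|` T.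
  move=> x [/H[/=|//] xb xb']; by move: xb; rewrite xb' ltxx.
apply: conv_hull_min; last first.
  move=> x Sx; have := Sb _ Sx; rewrite le_eqVlt => /orP[/eqP xb|xb]; last by left.
  by right; apply: sub_conv_hull.
apply/convex_setP => x y t t0 t1 xA yA.
have le z : ([set x | dot c x < b] `|` T) z -> dot c z <= b.
  by case=> [/ltW//|/Tb ->].
have t1' : 0 < 1 - t by rewrite subr_gt0.
case: (xA) => [xb|xT].
  left; rewrite /= dotD !dotZ; have /(ler_wpM2l (ltW t1')) := le _ yA.
  move: xb => /=; rewrite -(ltr_pM2l t0); lra.
case: (yA) => [yb|yT].
  left; rewrite /= dotD !dotZ; have /(ler_wpM2l (ltW t0)) := le _ xA.
  move: yb => /=; rewrite -(ltr_pM2l t1'); lra.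
by right; exact: (proj1 (convex_setP T) (@conv_hull_convex _)).
Qed.

Lemma affine_hull_affine S : affine_set (affine_hull S).
Proof. by move=> x y t xC yC C CS; move: (CS) => [aC _]; apply: aC; [exact: xC|exact: yC]. Qed.

Lemma sub_affine_hull S : S `<=` affine_hull S.
Proof. by move=> x Sx C [_]; exact. Qed.

Lemma affine_hull_min S A : affine_set A -> S `<=` A -> affine_hull S `<=` A.
Proof. by move=> cA SA x; apply. Qed.

Lemma affine_convex A : affine_set A -> @convex_set R E4 A.
Proof.
move=> aA; apply/convex_setP => x y t _ _ Ax Ay.
by rewrite addrC; have := aA y x t Ay Ax.
Qed.

Lemma affine_hull_conv_hull S : affine_hull (conv_hull S) = affine_hull S.
Proof.
apply/seteqP; split.
  apply: affine_hull_min; first exact: affine_hull_affine.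
  apply: conv_hull_min; last exact: sub_affine_hull.
  by apply: affine_convex; exact: affine_hull_affine.
apply: affine_hull_min; first exact: affine_hull_affine.
exact: (subset_trans (@sub_conv_hull S) (@sub_affine_hull _)).
Qed.

Lemma affine_translate p (U : {vspace E4}) : affine_set [set x | x - p \in U].
Proof.
move=> x y t /= xU yU.
have -> : (1 - t) *: x + t *: y - p = (1 - t) *: (x - p) + t *: (y - p).
  by apply/rowP => i; rewrite !mxE; ring.
by rewrite memvD// memvZ.
Qed.

(** [affine_set] speaks of combinations of two points only. Scaling about [p] is one of them, and a
    sum is twice a midpoint; together they generate all linear combinations. *)
Lemma affine_set_span A p (Y : seq E4) : affine_set A -> A p ->
  (forall y, y \in Y -> A (p + y)) -> forall x, x - p \in <<Y>>%VS -> A x.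
Proof.
move=> aA Ap AY.
have AZ v t : A (p + v) -> A (p + t *: v).
  move=> Av; have := aA _ _ t Ap Av.
  by congr (A _); apply/rowP => i; rewrite !mxE; ring.
have AD v w : A (p + v) -> A (p + w) -> A (p + (v + w)).
  move=> Av Aw; have vwA : A (p + 2^-1 *: (v + w)).
    have := aA _ _ 2^-1 Av Aw.
    by congr (A _); apply/rowP => i; rewrite !mxE; field.
  have := AZ _ 2 vwA.
  by congr (A _); apply/rowP => i; rewrite !mxE; field.
move=> x xY; have -> : x = p + (x - p) by rewrite addrC subrK.
have := coord_span (X := in_tuple Y) xY => ->.
elim/big_ind: _ => [|v w|i _]; [by rewrite addr0|exact: AD|].
by apply: AZ; apply: AY; rewrite mem_nth.
Qed.

(** The basis is chosen among the given vectors, so that its members still come from points of the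
    process. *)
Lemma free_basis_extraction (Y : seq E4) :
  exists Z, [/\ {subset Z <= Y}, free Z & <<Z>>%VS = <<Y>>%VS].
Proof.
elim: Y => [|y Y [Z [ZY fZ sZ]]]; first by exists [::]; split => //; exact: nil_free.
have [yZ|yZ] := boolP (y \in <<Z>>%VS).
  exists Z; split => //; first by move=> z /ZY zY; rewrite inE zY orbT.
  by rewrite span_cons -sZ; apply/esym/addv_idPr; rewrite -memvE.
exists (y :: Z); split.
- by move=> z; rewrite !inE => /orP[->//|/ZY ->]; rewrite orbT.
- by rewrite free_cons yZ.
- by rewrite !span_cons sZ.
Qed.

Lemma has_affine_dim_inj k l S : has_affine_dim k S -> has_affine_dim l S -> k = l.
Proof.
move=> [x [U [dU EU]]] [y [V [dV EV]]]; rewrite -dU -dV; congr (\dim _).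
have /seteqP[UV VU] := etrans (esym EU) EV.
have xV : x - y \in V by apply: UV; rewrite /= subrr mem0v.
have yU : y - x \in U by apply: VU; rewrite /= subrr mem0v.
apply/vspaceP => v; apply/idP/idP => vV.
  have /UV /= : (fun z => is_true (z - x \in U)) (x + v) by rewrite /= addrC addKr.
  have -> : x + v - y = (x - y) + v by rewrite addrAC.
  by rewrite rpredDl.
have /VU /= : (fun z => is_true (z - y \in V)) (y + v) by rewrite /= addrC addKr.
have -> : y + v - x = (y - x) + v by rewrite addrAC.
by rewrite rpredDl.
Qed.

(** Written as a function of a quadruple so that the facets lie in its image of a fourth power,
    which bounds their number. *)
Definition flat_section K (p : E4 * E4 * E4 * E4) : set E4 :=
  K `&` [set x | x - p.1.1.1 \in
    <<[:: p.1.1.2 - p.1.1.1; p.1.2 - p.1.1.1; p.2 - p.1.1.1]>>%VS].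

(** The tight points span the affine hull of the facet, so a basis of its direction can be extracted
    from their differences with [p0]; the facet is the part of the hull in the resulting flat. *)
Lemma facet_flat_section S F : finite_set S -> has_affine_dim 4 (conv_hull S) ->
  faces 3 (conv_hull S) F ->
  exists c b, [/\ c != 0, forall x, S x -> dot c x <= b &
  exists p0 p1 p2 p3 : E4, let T := [set x | S x /\ dot c x = b] in
    [/\ T p0, T p1, T p2, T p3 & F = flat_section (conv_hull S) (p0, p1, p2, p3)]].
Proof.
move=> finS dim4 [[c [b [Kb FE]]] dim3].
have Sb x : S x -> dot c x <= b by move=> Sx; apply: Kb; exact: sub_conv_hull.
(* For [c = 0] the face would be the whole hull, of dimension 4, or empty, without a dimension. *)
have c0 : c != 0.
  apply/eqP => c0; move: FE; rewrite c0.
  have [b0 FE|b0 FE] := eqVneq b 0.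
    have FK : F = conv_hull S.
      by rewrite FE; apply/seteqP; split=> [x []//|x Kx]; split=> //=; rewrite dot0l b0.
    by move: dim3; rewrite FK => dim3; have := has_affine_dim_inj dim3 dim4.
  have F0 : F = set0.
    apply/seteqP; split => // x; rewrite FE => -[_ /=]; rewrite dot0l => /eqP.
    by rewrite eq_sym (negbTE b0).
  move: dim3 => [x0 [U [_]]]; rewrite F0 => /seteqP[_ /(_ x0)] /=.
  rewrite subrr mem0v => /(_ isT); apply: (@affine_hull_min set0 set0) => //.
exists c, b; split => //; set T := [set x | _].
have FT : F = conv_hull T by rewrite FE face_conv_hull.
have finT : finite_set T by apply: sub_finite_set finS => x [].
move: dim3 => [x0 [U [dimU]]]; rewrite FT affine_hull_conv_hull => aU.
have [p0 Tp0] : T !=set0.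
  apply/set0P/negP => /eqP T0; move/seteqP: aU => [_ /(_ x0)] /=.
  rewrite subrr mem0v => /(_ isT); rewrite T0; apply: (@affine_hull_min set0 set0) => //.
have affE : affine_hull T = [set x | x - p0 \in U].
  rewrite aU; have : (fun x => is_true (x - x0 \in U)) p0.
    by have : affine_hull T p0 by [exact: sub_affine_hull]; rewrite aU.
  move=> pU; apply/seteqP; split => x /=.
    move=> xU; have -> : x - p0 = (x - x0) - (p0 - x0) by apply/rowP => i; rewrite !mxE; ring.
    by rewrite rpredB.
  move=> xU; have -> : x - x0 = (x - p0) + (p0 - x0) by rewrite subrKA.
  by rewrite rpredD.
pose Y := [seq x - p0 | x <- fset_set T].
have YP y : y \in Y -> T (p0 + y).
  by move=> /mapP[x xT ->]; rewrite addrC subrK; move: xT; rewrite in_fset_set// => /set_mem.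
have UY : U = <<Y>>%VS.
  apply/eqP; rewrite eqEsubv; apply/andP; split; apply/subvP => u uU.
    have : affine_hull T (p0 + u) by rewrite affE /= addrC addKr.
    move=> /(@affine_hull_min T [set x | x - p0 \in <<Y>>%VS] (@affine_translate _ _)).
    rewrite /= [p0 + u]addrC addrK; apply.
    move=> x Tx /=; apply: memv_span; apply: map_f; rewrite in_fset_set//; exact: mem_set.
  have := subvP (_ : (<<Y>> <= U)%VS) u uU; apply; apply/span_subvP => y /YP Ty.
  have : affine_hull T (p0 + y) by exact: sub_affine_hull.
  by rewrite affE /= addrC addKr.
have [Z [ZY fZ sZ]] := free_basis_extraction Y.
have /eqP sizeZ : size Z == 3.
  by move: fZ; rewrite /free sZ -UY dimU eq_sym.
case: Z sizeZ ZY fZ sZ => [//|y1 [//|y2 [//|y3 [|//]]]] _ ZY _ sZ.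
have T1 : T (p0 + y1) by apply/YP/ZY; rewrite !inE eqxx.
have T2 : T (p0 + y2) by apply/YP/ZY; rewrite !inE eqxx ?orbT.
have T3 : T (p0 + y3) by apply/YP/ZY; rewrite !inE eqxx ?orbT.
exists p0, (p0 + y1), (p0 + y2), (p0 + y3); split => //.
rewrite -FT /flat_section /= ![p0 + _]addrC !addrK sZ -UY -affE -(affine_hull_conv_hull T) -FT.
apply/seteqP; split => [x Fx|x [Kx aFx]].
  by split; [move: Fx; rewrite FE => -[]|exact: sub_affine_hull].
rewrite FE; split => //; move: x aFx {Kx}; apply: affine_hull_min.
  move=> x y t /= xb yb; rewrite dotD !dotZ xb yb; ring.
by move=> x; rewrite FE => -[].
Qed.

(** The free differences give the tight set dimension 3, and [q], lying off the hyperplane, raises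
    the dimension of the hull to 4. *)
Lemma tight_simplex_facet S c b p0 p1 p2 p3 q :
  (forall x, S x -> dot c x <= b) ->
  S `&` [set x | dot c x = b] = [set p0; p1; p2; p3] ->
  free [:: p1 - p0; p2 - p0; p3 - p0] ->
  S q -> dot c q < b ->
  has_affine_dim 4 (conv_hull S) /\
  faces 3 (conv_hull S) (conv_hull S `&` [set x | dot c x = b]).
Proof.
move=> Sb TE fr Sq qb.
have Tx x : [set p0; p1; p2; p3] x -> S x /\ dot c x = b by rewrite -TE => -[].
have [S0 b0] : S p0 /\ dot c p0 = b by apply: Tx; left; left; left.
have [S1 b1] : S p1 /\ dot c p1 = b by apply: Tx; left; left; right.
have [S2 b2] : S p2 /\ dot c p2 = b by apply: Tx; left; right.
have [S3 b3] : S p3 /\ dot c p3 = b by apply: Tx; right.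
split; last first.
  split; first by exists c, b; split => //; exact: conv_hull_dot_le.
  rewrite face_conv_hull// TE; exists p0, <<[:: p1 - p0; p2 - p0; p3 - p0]>>%VS.
  split; first by move: fr; rewrite /free => /eqP ->.
  rewrite affine_hull_conv_hull; apply/seteqP; split.
    apply: affine_hull_min; first exact: affine_translate.
    move=> x [[[->|->]|->]|->] /=; first by rewrite subrr mem0v.
    - by apply: memv_span; rewrite inE eqxx.
    - by apply: memv_span; rewrite !inE eqxx orbT.
    - by apply: memv_span; rewrite !inE eqxx !orbT.
  move=> x /=; apply: (@affine_set_span _ p0 [:: p1 - p0; p2 - p0; p3 - p0]).
  - exact: affine_hull_affine.
  - by apply: sub_affine_hull; left; left; left.
  - move=> y; rewrite !inE => /or3P[] /eqP ->; rewrite addrC subrK; apply: sub_affine_hull.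
    + by left; left; right.
    + by left; right.
    + by right.
exists p0, fullv; split; first by rewrite dimvf.
rewrite affine_hull_conv_hull; apply/seteqP; split => [x _|x _] /=; first by rewrite memvf.
have fr4 : free [:: q - p0; p1 - p0; p2 - p0; p3 - p0].
  rewrite free_cons fr andbT; apply/negP => qs.
  have : dot c q = b.
    suff : affine_set [set x | dot c x = b].
      move=> /(@affine_set_span _ p0) H; apply: (H _ b0 _ _ qs) => y; rewrite !inE.
      by move=> /or3P[] /eqP -> /=; rewrite addrC subrK.
    move=> x' y' t /= xb yb; rewrite dotD !dotZ xb yb; ring.
  by move: qb => /[swap] ->; rewrite ltxx.
apply: (@affine_set_span _ p0 [:: q - p0; p1 - p0; p2 - p0; p3 - p0]).
- exact: affine_hull_affine.
- exact: sub_affine_hull.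
- move=> y; rewrite !inE => /or4P[] /eqP ->; rewrite addrC subrK; exact: sub_affine_hull.
- have /eqP -> : <<[:: q - p0; p1 - p0; p2 - p0; p3 - p0]>>%VS == fullv.
    by rewrite eqEdim subvf dimvf /=; move: fr4; rewrite /free => /eqP ->.
  by rewrite memvf.
Qed.

End ConvexGeometry.

(** * Caps of the torus *)

Section Caps.
Set Implicit Arguments. Unset Strict Implicit.
Context {R : realType}.
Local Notation E4 := 'rV[R]_4.

Lemma polar_coordinates (x y : R) :
  exists A t, [/\ 0 <= A, - pi < t <= pi, x = A * cos t & y = A * sin t].
Proof.
have pi0 : 0 < pi :> R := pi_gt0 R.
pose A := Num.sqrt (x ^+ 2 + y ^+ 2).
have A2 : A ^+ 2 = x ^+ 2 + y ^+ 2 by rewrite sqr_sqrtr// addr_ge0// sqr_ge0.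
have [A0|A0] := eqVneq A 0.
  exists 0, pi; split => //; first by rewrite lexx andbT; lra.
    by rewrite mul0r; have := sqr_ge0 y; have := sqr_ge0 x; move: A2; rewrite A0; nra.
  by rewrite mul0r; have := sqr_ge0 y; have := sqr_ge0 x; move: A2; rewrite A0; nra.
have Ap : 0 < A by rewrite lt_def A0 sqrtr_ge0.
have z1 : -1 <= x / A <= 1.
  by rewrite ler_pdivlMr// ler_pdivrMr//; apply/andP; split; nra.
have zc : cos (acos (x / A)) = x / A by rewrite acosK// in_itv.
have s0 : 0 <= sin (acos (x / A)) by rewrite sin_ge0_pi// acos_ge0//= acos_lepi.
have s2 : (A * sin (acos (x / A))) ^+ 2 = y ^+ 2.
  rewrite exprMn sin2cos2 zc; have -> : A ^+ 2 * (1 - (x / A) ^+ 2) = A ^+ 2 - x ^+ 2 by field.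
  by rewrite A2; ring.
exists A; have [y0|y0] := leP 0 y.
  exists (acos (x / A)); split; first exact: ltW.
  - by rewrite acos_lepi// andbT; have := acos_ge0 z1; lra.
  - by rewrite zc; field.
  - move/eqP: s2; rewrite eqrXn2// => [/eqP->//|]; by rewrite mulr_ge0// ltW.
exists (- acos (x / A)); split; first exact: ltW.
- rewrite ltrN2 (le_trans _ (ltW pi0)) ?oppr_le0 ?acos_ge0// andbT acos_ltpi//.
  case/andP: z1 => z1 ->; rewrite andbT lt_neqAle z1 andbT; apply/eqP => zN.
  have xA : x = - A by rewrite -[x](divfK A0) -zN mulN1r.
  by move: A2; rewrite xA sqrrN; nra.
- by rewrite cosN zc; field.
- have : (A * sin (acos (x / A))) ^+ 2 = (- y) ^+ 2 by rewrite sqrrN.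
  move/eqP; rewrite eqrXn2//; [|by rewrite mulr_ge0// ltW|lra].
  by move=> /eqP yE; rewrite sinN mulrN yE opprK.
Qed.

Lemma cos_lt_abs (x y : R) : `|x| < y -> y <= pi -> cos y < cos x.
Proof.
move=> xy ypi; rewrite -(cos_norm x).
have y0 : 0 <= y := le_trans (normr_ge0 x) (ltW xy).
by rewrite ltr_cos// in_itv/= ?normr_ge0 ?y0//= (le_trans (ltW xy)).
Qed.

(* Half of the budget [h] fixes the inner half-width [s]; spending all of it at
   most doubles the angle, because [1 - cos (2s) >= 2 (1 - cos s)]. *)
Lemma cap_half_width (A h : R) : 0 <= A -> 0 <= h ->
  exists s, [/\ 0 <= s, s <= pi,
    forall d, `|d| < s -> A * (1 - cos d) <= h / 2,
    forall d, 0 < A -> `|d| < s -> A * (1 - cos d) < h / 2 &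
    forall d, `|d| <= pi -> A * (1 - cos d) <= h -> `|d| <= 2 * s].
Proof.
move=> A0 h0; have pi0 : 0 < pi :> R := pi_gt0 R.
suff [s [s0 spi H1 H2]] : exists s, [/\ 0 <= s, s <= pi,
    forall d, 0 < A -> `|d| < s -> A * (1 - cos d) < h / 2 &
    forall d, `|d| <= pi -> A * (1 - cos d) <= h -> `|d| <= 2 * s].
  exists s; split => // d ds; move: A0; rewrite le_eqVlt => /orP[/eqP <-|Ap].
    by rewrite mul0r; lra.
  exact/ltW/H1.
have [Ah|Ah] := leP (2 * A) (h / 2).
  exists pi; split => //; first exact: ltW.
    move=> d Ap dpi; have := cos_lt_abs dpi (lexx _); rewrite cospi.
    move=> cd; have : A * (1 - cos d) < A * 2 by rewrite ltr_pM2l//; lra.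
    lra.
  by move=> d dpi _; lra.
have Ap : 0 < A by lra.
pose z := 1 - h / (2 * A).
have zE : A * (1 - z) = h / 2 by rewrite /z; field; lra.
have z1 : -1 <= z <= 1 by apply/andP; split; nra.
have cs : cos (acos z) = z by rewrite acosK// in_itv.
have s0 := acos_ge0 z1; have spi := acos_lepi z1.
exists (acos z); split => //.
  by move=> d _ ds; have := cos_lt_abs ds spi; rewrite cs -zE ltr_pM2l//; lra.
move=> d dpi dh; rewrite leNgt; apply/negP => sd.
(* The assumption [2 * s < |d| <= pi] yields [cos s >= 0], which the doubling inequality needs. *)
have s2 : acos z < pi / 2 by lra.
have cz : 0 <= z by rewrite -cs cos_ge0_pihalf//; apply/andP; split; lra.
have : cos `|d| < cos (2 * acos z).
  by rewrite ltr_cos// in_itv/=; apply/andP; split; lra.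
rewrite cos_norm mulr_natl cos_mulr2n cs => H.
by nra.
Qed.

Definition arc_length i : R := 2 * pi / 2 ^+ i.

Lemma arc_length_gt0 i : 0 < arc_length i.
Proof. by rewrite /arc_length divr_gt0 ?exprn_gt0// mulr_gt0// pi_gt0. Qed.

Lemma arc_lengthS i : arc_length i = 2 * arc_length i.+1.
Proof. by rewrite /arc_length exprS; field; rewrite expf_neq0. Qed.

Lemma arc_length_le i j : (i <= j)%N -> arc_length j <= arc_length i.
Proof.
move=> /subnK <-; elim: (j - i)%N => // n IH; apply: le_trans IH.
by rewrite addSn (arc_lengthS (n + i)); have := arc_length_gt0 (n + i).+1; lra.
Qed.

(** The level is the first whose arcs have length at most [s], but never finer than [L]. Below [L]
    the comparison is two-sided; at [L] only the upper bound on [s] is sure. *)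
Lemma dyadic_level L (s : R) : 0 <= s -> s <= pi ->
  exists i, [/\ (i <= L)%N, s < 2 * arc_length i & (i < L)%N -> arc_length i <= s].
Proof.
move=> s0 spi; elim: L => [|L [i [iL si is_]]].
  by exists 0; split => //; rewrite /arc_length expr0; have := pi_gt0 R; lra.
have [iLt|] := ltnP i L; first by exists i; split => // [|_]; [exact: ltnW|exact: is_].
move=> Li; have {iL Li}iL : i = L by apply/eqP; rewrite eqn_leq iL.
have [ls|ls] := leP (arc_length i) s; first by exists i; split => //; rewrite iL.
by exists L.+1; split => //; rewrite ?ltnn// -arc_lengthS -iL.
Qed.

Lemma nat_cell (n : nat) (x : R) : 0 < x -> x <= n%:R ->
  exists2 j, (j < n)%N & j%:R < x <= j.+1%:R.
Proof.
elim: n => [|n IH] x0 xn; first by lra.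
have [xn'|nx] := leP x n%:R.
  by have [j jn jx] := IH x0 xn'; exists j => //; rewrite ltnS ltnW.
by exists n => //; rewrite nx.
Qed.

Definition arc i (j : nat) : set R :=
  `]- pi + j%:R * arc_length i, - pi + (j%:R + 1) * arc_length i].

(* The angles of [arc i j] and of its four neighbours on each side; the shifts
   by [2 * pi] account for the periodicity. *)
Definition wide_arc i (j : nat) : set R := `]- pi, pi] `&`
  \bigcup_(n in [set k : nat | (k < 3)%N])
  [set` `]- pi + (j%:R - 4) * arc_length i - 2 * pi * (n%:R - 1),
    - pi + (j%:R + 5) * arc_length i - 2 * pi * (n%:R - 1)]].

Lemma arc_exists i (t : R) : - pi < t <= pi -> exists2 j, (j < 2 ^ i)%N & arc i j t.
Proof.
move=> /andP[t0 tpi]; have l0 := arc_length_gt0 i.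
have [||j j2 /andP[j1 j1']] := @nat_cell (2 ^ i) ((t + pi) / arc_length i).
- by rewrite divr_gt0//; lra.
- rewrite ler_pdivrMr// natrX /arc_length.
  have -> : 2 ^+ i * (2 * pi / 2 ^+ i) = 2 * pi :> R by field; rewrite expf_neq0.
  lra.
exists j => //; rewrite /arc/= in_itv/=.
move: j1 j1'; rewrite ltr_pdivlMr// ler_pdivrMr// -natr1 => j1 j1'.
by apply/andP; split; lra.
Qed.

Lemma arc_dist i j (t u : R) : arc i j t -> arc i j u -> `|t - u| < arc_length i.
Proof.
rewrite /arc/= !in_itv/= => /andP[t1 t2] /andP[u1 u2].
by rewrite ltr_norml; apply/andP; split; lra.
Qed.

Lemma wide_arc_near i j (t u : R) n : arc i j t -> - pi < u <= pi -> (n < 3)%N ->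
  `|u - t + 2 * pi * (n%:R - 1)| < 4 * arc_length i -> wide_arc i j u.
Proof.
rewrite /arc/= in_itv/= => /andP[t1 t2] /andP[u1 u2] n3.
rewrite ltr_norml => /andP[d1 d2]; split; first by rewrite /= in_itv/= u1.
by exists n => //; rewrite /= in_itv/=; apply/andP; split; lra.
Qed.

(** The difference lies strictly between [- 2 * pi] and [2 * pi], so one of three shifts
    suffices. *)
Lemma angle_reduction (t u : R) : - pi < t <= pi -> - pi < u <= pi ->
  exists2 n, (n < 3)%N & `|u - t + 2 * pi * (n%:R - 1)| <= pi /\
    cos (u - t + 2 * pi * (n%:R - 1)) = cos (u - t).
Proof.
move=> /andP[t1 t2] /andP[u1 u2]; have pi0 : 0 < pi :> R := pi_gt0 R.
have [d1|d1] := ltP (u - t) (- pi).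
  exists 2%N => //; split; first by rewrite ler_norml; apply/andP; split; lra.
  by have -> : u - t + 2 * pi * (2%:R - 1) = u - t + pi *+ 2 by [ring]; rewrite cosD2pi.
have [d2|d2] := ltP pi (u - t).
  exists 0%N => //; split; first by rewrite ler_norml; apply/andP; split; lra.
  rewrite -[RHS](_ : cos (u - t - pi *+ 2 + pi *+ 2) = _); last by rewrite subrK.
  by rewrite cosD2pi; congr cos; ring.
exists 1%N => //; rewrite subrr mulr0 addr0; split => //.
by rewrite ler_norml d1 d2.
Qed.

Lemma dot_torus_point (c : E4) (u : R * R) :
  dot c (torus_point u) =
  c 0 0 * cos u.1 + c 0 1 * sin u.1 + (c 0 2%:R * cos u.2 + c 0 3%:R * sin u.2).
Proof.
rewrite /dot !big_ord_recl big_ord0 addr0 !mxE /=.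
rewrite !addrA; congr (_ * _ + _ * _ + _ * _ + _ * _); congr (c _ _); exact: val_inj.
Qed.

Lemma row4_eq0 (c : E4) : c 0 0 = 0 -> c 0 1 = 0 -> c 0 2%:R = 0 -> c 0 3%:R = 0 -> c = 0.
Proof.
move=> c0 c1 c2 c3; apply/rowP => -[[|[|[|[|//]]]] ilt]; rewrite mxE.
- by rewrite -[RHS]c0; congr (c _ _); exact: val_inj.
- by rewrite -[RHS]c1; congr (c _ _); exact: val_inj.
- by rewrite -[RHS]c2; congr (c _ _); exact: val_inj.
- by rewrite -[RHS]c3; congr (c _ _); exact: val_inj.
Qed.

Definition torus_rect (U V : set R) : set E4 := @torus_point R @` (U `*` V).

(** With polar coordinates [(A, t)] and [(B, t')] for the two halves of [c], the cap has center
    [(t, t')] and budget [h = A + B - b]. A point with offsets below [s] and [s'] spends less than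
    [h] and would violate the support inequality, so it is not in [S]; a tight point spends exactly
    [h], so its offsets are at most [2 * s] and [2 * s']. *)
Lemma tight_points_in_wide_cell L (S : set E4) (c p : E4) (b : R) :
  c != 0 -> S `<=` @clifford_torus R -> (forall x, S x -> dot c x <= b) ->
  S p -> dot c p = b ->
  exists i i' j j', [/\ (i + i' <= L)%N, (j < 2 ^ i)%N, (j' < 2 ^ i')%N,
    (i + i' < L)%N -> S `&` torus_rect (arc i j) (arc i' j') = set0 &
    forall x, S x -> dot c x = b -> torus_rect (wide_arc i j) (wide_arc i' j') x].
Proof.
move=> c0 SX Sb Sp pb.
have [A [t [A0 tpi cA0 cA1]]] := polar_coordinates (c 0 0) (c 0 1).
have [B [t' [B0 tpi' cB0 cB1]]] := polar_coordinates (c 0 2%:R) (c 0 3%:R).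
have dotE u : dot c (torus_point u) = A * cos (u.1 - t) + B * cos (u.2 - t').
  by rewrite dot_torus_point cA0 cA1 cB0 cB1 !cosB; ring.
pose h := A + B - b.
have gap x : A + B - dot c (torus_point x) =
    A * (1 - cos (x.1 - t)) + B * (1 - cos (x.2 - t')) by rewrite dotE; ring.
have nn D (d : R) : 0 <= D -> 0 <= D * (1 - cos d).
  by move=> D0; rewrite mulr_ge0// subr_ge0 cos_le1.
have h0 : 0 <= h.
  have [u _ up] := SX _ Sp; rewrite /h -pb -up gap addr_ge0// nn//.
have [s [s0 spi sA1 sA2 sA3]] := cap_half_width A0 h0.
have [s' [s0' spi' sB1 sB2 sB3]] := cap_half_width B0 h0.
(* One positive amplitude makes the inner inequality strict; this is where [c != 0] enters. *)
have ABpos : 0 < A \/ 0 < B.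
  move: A0 B0; rewrite !le_eqVlt => /orP[/eqP A0|]; last by left.
  move=> /orP[/eqP B0|]; last by right.
  exfalso; move/eqP: c0; apply.
  by apply: row4_eq0; rewrite ?cA0 ?cA1 ?cB0 ?cB1 -?A0 -?B0 mul0r.
have inner x : S (torus_point x) -> `|x.1 - t| < s -> `|x.2 - t'| < s' -> False.
  move=> Sx xs xs'; have := Sb _ Sx; have := gap x.
  case: ABpos => [Ap|Bp].
    by have := sA2 _ Ap xs; have := sB1 _ xs'; rewrite /h; lra.
  by have := sA1 _ xs; have := sB2 _ Bp xs'; rewrite /h; lra.
have [i [iL is_ ls]] := dyadic_level L s0 spi.
have [i' [iL' is_' ls']] := dyadic_level L s0' spi'.
have outer k k' j j' : s < 2 * arc_length k -> s' < 2 * arc_length k' ->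
    arc k j t -> arc k' j' t' ->
    forall x, S x -> dot c x = b -> torus_rect (wide_arc k j) (wide_arc k' j') x.
  move=> sk sk' tj tj' x Sx xb; have [u [/= u1 u2] ux] := SX _ Sx.
  rewrite -ux; exists u => //; have := gap u; rewrite ux xb -/h => hE.
  have h1 := nn A (u.1 - t) A0; have h2 := nn B (u.2 - t') B0.
  move: u1 u2; rewrite /= !in_itv/= => u1 u2; split => /=.
    have [n n3 [npi nc]] := angle_reduction tpi u1.
    apply: (wide_arc_near tj u1 n3); apply: (@le_lt_trans _ _ (2 * s)); last lra.
    by apply: sA3 => //; rewrite nc; lra.
  have [n n3 [npi nc]] := angle_reduction tpi' u2.
  apply: (wide_arc_near tj' u2 n3); apply: (@le_lt_trans _ _ (2 * s')); last lra.
  by apply: sB3 => //; rewrite nc; lra.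
have [iiL|iiL] := ltnP (i + i') L.
  have [j j2 tj] := arc_exists i tpi; have [j' j2' tj'] := arc_exists i' tpi'.
  exists i, i', j, j'; split => //; first exact: ltnW.
    move=> _; apply/seteqP; split => // x [Sx [u [u1 u2] ux]].
    apply: (inner u); first by rewrite ux.
      apply: lt_le_trans (arc_dist u1 tj) (ls _).
      exact: leq_ltn_trans (leq_addr _ _) iiL.
    apply: lt_le_trans (arc_dist u2 tj') (ls' _).
    exact: leq_ltn_trans (leq_addl _ _) iiL.
  exact: outer.
(* For a thin cap, the second level is coarsened from [i'] to [L - i]. This lengthens the arcs, so
   the tight points stay in the wide cell. *)
have [j j2 tj] := arc_exists i tpi; have [j' j2' tj'] := arc_exists (L - i) tpi'.
exists i, (L - i)%N, j, j'; split => //; first by rewrite subnKC.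
  by rewrite subnKC// ltnn.
apply: outer => //; apply: lt_le_trans is_' _; rewrite ler_pM2l//.
by apply: arc_length_le; rewrite leq_subLR.
Qed.

End Caps.

(** * Area on the torus *)

Section TorusMeasure.
Set Implicit Arguments. Unset Strict Implicit.
Context {R : realType}.
Local Notation E4 := 'rV[R]_4.

Lemma continuous_torus_point : continuous (@torus_point R).
Proof.
move=> u; apply/cvg_ballP => e e0.
have cc : (fun v : R * R => cos v.1) v @[v --> u] --> cos u.1.
  by apply: continuous_comp; [exact: cvg_fst|exact: continuous_cos].
have cs : (fun v : R * R => sin v.1) v @[v --> u] --> sin u.1.
  by apply: continuous_comp; [exact: cvg_fst|exact: continuous_sin].
have cc' : (fun v : R * R => cos v.2) v @[v --> u] --> cos u.2.
  by apply: continuous_comp; [exact: cvg_snd|exact: continuous_cos].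
have cs' : (fun v : R * R => sin v.2) v @[v --> u] --> sin u.2.
  by apply: continuous_comp; [exact: cvg_snd|exact: continuous_sin].
move/cvg_ballP : cc => /(_ e e0) cc; move/cvg_ballP : cs => /(_ e e0) cs.
move/cvg_ballP : cc' => /(_ e e0) cc'; move/cvg_ballP : cs' => /(_ e e0) cs'.
near=> v; split => // i j; rewrite !mxE.
case: j => -[|[|[|[|//]]]] /= _.
- by near: v.
- by near: v.
- by near: v.
- by near: v.
Unshelve. all: by end_near. Qed.

Lemma cos_eq1 (d : R) : `|d| < 2 * pi -> cos d = 1 -> d = 0.
Proof.
move=> dpi; rewrite -cos_norm; have := normr_ge0 d; rewrite le_eqVlt => /orP[/eqP|d0].
  by move=> /esym/eqP; rewrite normr_eq0 => /eqP.
have -> : `|d| = (`|d| / 2) *+ 2 by rewrite -mulr_natr divfK.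
rewrite cos_mulr2n => c1; have : 0 < sin (`|d| / 2).
  by rewrite sin_gt0_pi//; apply/andP; split; lra.
have := sin2cos2 (`|d| / 2); nra.
Qed.

Lemma torus_point_inj (u v : R * R) : param_domain u -> param_domain v ->
  torus_point u = torus_point v -> u = v.
Proof.
case: u v => [u1 u2] [v1 v2]; rewrite /param_domain/= !in_itv/=.
move=> [/= /andP[a1 a2] /andP[a3 a4]] [/= /andP[b1 b2] /andP[b3 b4]] /rowP uv.
have c1 : cos u1 = cos v1 by have := uv 0; rewrite !mxE.
have s1 : sin u1 = sin v1 by have := uv 1; rewrite !mxE.
have c2 : cos u2 = cos v2 by have := uv 2%:R; rewrite !mxE.
have s2 : sin u2 = sin v2 by have := uv 3%:R; rewrite !mxE.
congr pair; apply/eqP; rewrite -subr_eq0; apply/eqP; apply: cos_eq1.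
- by rewrite ltr_norml; apply/andP; split; lra.
- by rewrite cosB c1 s1 -!expr2 cos2Dsin2.
- by rewrite ltr_norml; apply/andP; split; lra.
- by rewrite cosB c2 s2 -!expr2 cos2Dsin2.
Qed.

Lemma torus_point_imageD (C D : set (R * R)) :
  C `<=` @param_domain R -> D `<=` @param_domain R ->
  @torus_point R @` (C `\` D) = @torus_point R @` C `\` @torus_point R @` D.
Proof.
move=> CD DD; apply/seteqP; split => [x [u [Cu Du] <-]|x [[u Cu <-] xD]].
  split; first by exists u.
  by move=> [v Dv /torus_point_inj uv]; apply: Du; rewrite -uv//; [exact: DD|exact: CD].
by exists u => //; split => // Du; apply: xD; exists u.
Qed.

Lemma torus_point_image_disjoint (C D : set (R * R)) :
  C `<=` @param_domain R -> D `<=` @param_domain R -> C `&` D = set0 ->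
  @torus_point R @` C `&` @torus_point R @` D = set0.
Proof.
move=> CD DD /seteqP[CD0 _]; apply/seteqP; split => // x [[u Cu <-] [v Dv vu]].
apply: (CD0 u); split => //.
by rewrite -(torus_point_inj (DD _ Dv) (CD _ Cu) vu).
Qed.

Local Notation lebesgue2 := ((@lebesgue_measure R) \x (@lebesgue_measure R))%E.

Lemma mes2_image (C : set (R * R)) : C `<=` @param_domain R ->
  mes2 (@torus_point R @` C) = lebesgue2 C.
Proof.
move=> CD; rewrite /mes2; congr (lebesgue2 _); apply/seteqP; split.
  by move=> u [Du [v Cv vu]]; rewrite -(torus_point_inj (CD _ Cv) Du vu).
by move=> u Cu; split; [exact: CD|exists u].
Qed.

Definition area (C : set (R * R)) : R := fine (lebesgue2 C).

(** That the image is Borel is carried along rather than derived from measurability of [C]: it holds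
    for compact rectangles and passes to countable unions and, [torus_point] being injective on the
    domain, to differences. *)
Definition chart (C : set (R * R)) : Prop :=
  [/\ C `<=` @param_domain R, measurable C & borel (@torus_point R @` C)].

Lemma chartD C D : chart C -> chart D -> chart (C `\` D).
Proof.
move=> [CD mC bC] [DD mD bD]; split; [by move=> u [/CD]|exact: measurableD|].
rewrite torus_point_imageD//; exact: (@measurableD _ (g_sigma_algebraType _)).
Qed.

Lemma chart_bigcup (F : nat -> set (R * R)) (P : set nat) :
  (forall n, P n -> chart (F n)) -> chart (\bigcup_(n in P) F n).
Proof.
move=> cF; split.
- by move=> u [n Pn Fu]; have [FD _ _] := cF _ Pn; exact: FD.
- by apply: bigcup_measurable => n Pn; have [] := cF _ Pn.
- rewrite image_bigcup; apply: (@bigcup_measurable _ (g_sigma_algebraType _)) => n Pn.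
  by have [] := cF _ Pn.
Qed.

Lemma closed_borel (A : set E4) : closed A -> borel A.
Proof.
move=> cA; rewrite -(setCK A); apply: (@measurableC _ (g_sigma_algebraType _)).
by apply: sub_sigma_algebra; rewrite /= openC.
Qed.

Lemma itv_oc_bigcup (a b : R) :
  `]a, b]%classic = \bigcup_n [set` `[a + n.+1%:R^-1, b]].
Proof.
apply/seteqP; split => x /=.
  rewrite in_itv/= => /andP[ax xb].
  have [n n0 nx] : exists2 n : nat, 0 < n.+1%:R^-1 :> R & a + n.+1%:R^-1 <= x.
    have xa : 0 < x - a by rewrite subr_gt0.
    exists (Num.truncn (x - a)^-1) => //; rewrite -lerBrDl.
    rewrite invf_ple ?posrE// ltW//; exact: truncnS_gt.
  by exists n => //=; rewrite in_itv/= nx.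
move=> [n _ /=]; rewrite !in_itv/= => /andP[ax ->]; rewrite andbT.
by apply: lt_le_trans ax; rewrite ltrDl.
Qed.

Lemma setX_bigcup (F G : nat -> set R) (P Q : set nat) :
  (\bigcup_(n in P) F n) `*` (\bigcup_(m in Q) G m) =
  \bigcup_(n in P) \bigcup_(m in Q) (F n `*` G m).
Proof.
apply/seteqP; split.
  by move=> [u v] [/= [n Pn un] [m Qm vm]]; exists n => //; exists m.
by move=> [u v] [n Pn [m Qm [/= un vm]]]; split; [exists n|exists m].
Qed.

Lemma compact_chart (a b c d : R) : - pi < a -> b <= pi -> - pi < c -> d <= pi ->
  chart (`[a, b] `*` `[c, d]).
Proof.
move=> a0 bp c0 dp; split.
- move=> [u v] [/=]; rewrite !in_itv/= => /andP[u1 u2] /andP[v1 v2].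
  by split; rewrite /= in_itv/=; apply/andP; split; lra.
- exact: measurableX.
- apply: closed_borel; apply: compact_closed; first exact: norm_hausdorff.
  apply: continuous_compact; first exact/continuous_subspaceT/continuous_torus_point.
  by apply: compact_setX; exact: segment_compact.
Qed.

(** A half-open rectangle is a countable union of compact ones, whose left ends are strictly above
    [- pi]. *)
Lemma rect_chart (a b c d : R) : - pi <= a -> b <= pi -> - pi <= c -> d <= pi ->
  chart (`]a, b] `*` `]c, d]).
Proof.
move=> a0 bp c0 dp.
rewrite !itv_oc_bigcup setX_bigcup.
apply: chart_bigcup => n _; apply: chart_bigcup => m _; apply: compact_chart => //.
  by rewrite (le_lt_trans a0)// ltrDl.
by rewrite (le_lt_trans c0)// ltrDl.
Qed.

Lemma chart_torus_borel C : chart C -> torus_borel (@torus_point R @` C).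
Proof. by move=> [CD _ bC]; split => // x [u Cu <-]; exists u => //; exact: CD. Qed.

Lemma lebesgue2_rect_le (U V : set R) (a b : R) : measurable U -> measurable V ->
  (lebesgue_measure U <= a%:E)%E -> (lebesgue_measure V <= b%:E)%E ->
  (lebesgue2 (U `*` V) <= (a * b)%:E)%E.
Proof.
move=> mU mV Ua Vb; rewrite product_measure1E// EFinM.
by apply: lee_pmul.
Qed.

Lemma chart_fin C : chart C -> lebesgue2 C = (area C)%:E.
Proof.
move=> [CD mC _]; rewrite /area fineK// fin_real//.
rewrite (@lt_le_trans _ _ 0%E) ?ltNyr ?measure_ge0//=.
apply: (@le_lt_trans _ _ ((2 * pi * (2 * pi))%:E : \bar R)); last exact: ltry.
apply: (@le_trans _ _ (lebesgue2 (@param_domain R))).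
  by apply: le_measure => //; rewrite inE//; exact: measurableX.
have pi0 := pi_gt0 R.
apply: lebesgue2_rect_le; [exact: measurable_itv|exact: measurable_itv| |];
  rewrite lebesgue_measure_itv/= lte_fin.
  by case: ifP => _; rewrite ?lee_fin; lra.
by case: ifP => _; rewrite ?lee_fin; lra.
Qed.

Lemma area_ge0 C : 0 <= area C.
Proof. by rewrite /area fine_ge0. Qed.

Lemma area_le C D : chart C -> chart D -> C `<=` D -> area C <= area D.
Proof.
move=> cC cD CD; rewrite -lee_fin -!chart_fin//; case: cC cD => [_ mC _] [_ mD _].
by apply: le_measure => //; rewrite inE.
Qed.

Lemma area_rect (a b c d : R) : - pi <= a -> a <= b -> b <= pi ->
  - pi <= c -> c <= d -> d <= pi ->
  area (`]a, b] `*` `]c, d]) = (b - a) * (d - c).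
Proof.
move=> a0 ab bp c0 cd dp; rewrite /area product_measure1E;
  [|exact: measurable_itv|exact: measurable_itv].
transitivity (fine (lebesgue_measure `]a, b] * lebesgue_measure `]c, d])%E) => //.
rewrite !lebesgue_measure_itv/= !lte_fin.
move: ab cd; rewrite !le_eqVlt => /orP[/eqP <-|ab].
  by rewrite ltxx mul0e subrr mul0r.
rewrite ab => /orP[/eqP <-|cd]; first by rewrite ltxx mule0 subrr mulr0.
by rewrite cd.
Qed.

Lemma arc_subset i j : (j < 2 ^ i)%N ->
  - pi <= - pi + j%:R * @arc_length R i /\ - pi + (j%:R + 1) * @arc_length R i <= pi.
Proof.
move=> ji; have l0 := @arc_length_gt0 R i; split.
  by rewrite lerDl mulr_ge0// ltW.
have l2 : 2 ^+ i * arc_length i = 2 * pi :> R.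
  by rewrite /arc_length; field; rewrite expf_neq0.
have : (j%:R + 1) * arc_length i <= 2 ^+ i * arc_length i :> R.
  by rewrite ler_pM2r// natr1 -natrX ler_nat.
lra.
Qed.

Lemma arc_chart i j i' j' : (j < 2 ^ i)%N -> (j' < 2 ^ i')%N ->
  chart (@arc R i j `*` arc i' j').
Proof.
move=> /arc_subset[a b] /arc_subset[c d]; exact: rect_chart.
Qed.

Lemma area_arc i j i' j' : (j < 2 ^ i)%N -> (j' < 2 ^ i')%N ->
  area (@arc R i j `*` arc i' j') = arc_length i * arc_length i'.
Proof.
move=> /arc_subset[a b] /arc_subset[c d].
have l0 := @arc_length_gt0 R i; have l0' := @arc_length_gt0 R i'.
by rewrite area_rect//; [ring|nra|nra].
Qed.

Lemma wide_arcE i j : @wide_arc R i j = \bigcup_(n in [set k : nat | (k < 3)%N])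
  [set` `] (Num.max (- pi) (- pi + (j%:R - 4) * arc_length i - 2 * pi * (n%:R - 1))),
   (Num.min pi (- pi + (j%:R + 5) * arc_length i - 2 * pi * (n%:R - 1)))]].
Proof.
rewrite /wide_arc setI_bigcupr; apply: eq_bigcupr => n _; apply/seteqP; split => x /=.
  by rewrite !in_itv/= gt_max le_min => -[/andP[-> ->] /andP[-> ->]].
by rewrite !in_itv/= gt_max le_min => /andP[/andP[-> ->] /andP[-> ->]].
Qed.

Lemma wide_arc_chart i j i' j' : chart (@wide_arc R i j `*` wide_arc i' j').
Proof.
rewrite !wide_arcE setX_bigcup.
apply: chart_bigcup => n _; apply: chart_bigcup => m _; apply: rect_chart.
- by rewrite le_max lexx.
- by rewrite ge_min lexx.
- by rewrite le_max lexx.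
- by rewrite ge_min lexx.
Qed.

Lemma measurable_wide_arc i j : measurable (@wide_arc R i j).
Proof. by rewrite wide_arcE; apply: bigcup_measurable => n _; exact: measurable_itv. Qed.

(** Three translates, each nine arcs long; overlaps and truncation are ignored. *)
Lemma lebesgue_wide_arc i j : (lebesgue_measure (@wide_arc R i j) <= (27 * arc_length i)%:E)%E.
Proof.
pose F (n : nat) : set R := [set` `]- pi + (j%:R - 4) * arc_length i - 2 * pi * (n%:R - 1),
    - pi + (j%:R + 5) * arc_length i - 2 * pi * (n%:R - 1)]].
have l0 := @arc_length_gt0 R i.
have mF n : lebesgue_measure (F n) = (9 * arc_length i)%:E.
  rewrite lebesgue_measure_itv/= lte_fin ifT; last by nra.
  by rewrite -EFinB; congr EFin; ring.
have mmF n : measurable (F n) by exact: measurable_itv.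
apply: (@le_trans _ _ (lebesgue_measure (F 0 `|` (F 1 `|` F 2)))).
  apply: le_measure; rewrite ?inE//;
    [exact: measurable_wide_arc|by apply: measurableU; [|apply: measurableU]; exact: mmF|].
  move=> x [_ [[|[|[|//]]] _ Fx]]; [by left|by right; left|by right; right].
have -> : ((27 * arc_length i)%:E =
  (9 * arc_length i)%:E + ((9 * arc_length i)%:E + (9 * arc_length i)%:E) :> \bar R)%E.
  by rewrite -!EFinD; congr EFin; ring.
rewrite -{1}(mF 0%N) -{1}(mF 1%N) -(mF 2%N).
have H1 : (lebesgue_measure (F 0%N `|` (F 1%N `|` F 2%N)) <=
    lebesgue_measure (F 0%N) + lebesgue_measure (F 1%N `|` F 2%N))%E.
  by apply: measureU2; [exact: mmF|apply: measurableU; exact: mmF].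
apply: (le_trans H1); apply: leeD => //.
by apply: measureU2; exact: mmF.
Qed.

Lemma area_wide_arc i j i' j' :
  area (@wide_arc R i j `*` wide_arc i' j') <= 729 * (arc_length i * arc_length i').
Proof.
rewrite -lee_fin -chart_fin; last exact: wide_arc_chart.
have -> : 729 * (arc_length i * arc_length i') =
  (27 * arc_length i) * (27 * arc_length i') :> R by ring.
by apply: lebesgue2_rect_le; [exact: measurable_wide_arc|exact: measurable_wide_arc|
  exact: lebesgue_wide_arc|exact: lebesgue_wide_arc].
Qed.

End TorusMeasure.

(** * Counts of a Poisson process *)

Section PoissonCounts.
Set Implicit Arguments. Unset Strict Implicit.
Context {R : realType}.

Lemma poisson_prob_set1 (r : R) k : 0 <= r ->
  poisson_prob r 0 [set k] = (r ^+ k / k`!%:R * expR (- r))%:E.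
Proof.
rewrite le_eqVlt /poisson_prob /poisson_pmf => /orP[/eqP <-|r0].
  rewrite ltxx oppr0 expR0 mulr1 diracE expr0n; congr EFin.
  have -> : (0%N \in [set k]) = (k == 0%N).
    by apply/idP/eqP => [/set_mem/= ->//|->]; apply/mem_set.
  by case: k => [|k] /=; rewrite ?fact0 ?divr1 ?mul0r.
rewrite r0 esum_set1//; last by rewrite lee_fin mulr_ge0// ?expR_ge0// divr_ge0// exprn_ge0// ltW.
Qed.

Lemma expR_nneseries (x : R) : 0 <= x ->
  (\sum_(k <oo) (x ^+ k / k`!%:R)%:E)%E = (expR x)%:E.
Proof.
move=> x0; rewrite /expR -EFin_lim; last exact: is_cvg_series_exp_coeff.
by apply/congr_lim/funext => n /=; rewrite /series/= -sumEFin.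
Qed.

(* The integral of a nonnegative function is a supremum over the simple functions
   below it, so it is monotone without measurability; this is why the
   measurability of the number of facets is never needed. *)
Lemma le_integral_nonmeasurable d (T : measurableType d) (mu : {measure set T -> \bar R})
  (f g : T -> \bar R) : (forall x, 0 <= f x)%E -> (forall x, f x <= g x)%E ->
  (\int[mu]_x f x <= \int[mu]_x g x)%E.
Proof.
move=> f0 fg; have g0 x : (0 <= g x)%E by exact: le_trans (fg x).
rewrite /integral !patch_setT.
have -> : (f^\+)%E = f by apply/funext => x; rewrite unlock; exact/max_idPl.
have -> : (g^\+)%E = g by apply/funext => x; rewrite unlock; exact/max_idPl.
have -> : (f^\-)%E = (g^\-)%E.
  apply/funext => x; rewrite unlock.
  by rewrite !(max_idPr _)// oppe_le0.
apply: leeB => //; apply: le_ereal_sup => _ [h hf <-]; exists h => // x.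
exact: le_trans (hf x) (fg x).
Qed.

Context {d : measure_display} {Omega : measurableType d}.
Variables (P : probability Omega R) (rate : R) (X : Omega -> set 'rV[R]_4).
Hypothesis rate_gt0 : 0 < rate.
Hypothesis PX : poisson_process P rate X.

Definition count (C : set (R * R)) : Omega -> nat := num_points X (@torus_point R @` C).

Lemma measurable_count_eq C k : chart C -> measurable [set w | count C w = k].
Proof.
move=> cC; case: PX => _ mX _ _.
have := mX _ (chart_torus_borel cC) measurableT [set k] I.
by rewrite setTI; apply.
Qed.

Lemma measurable_count_fun C (g : nat -> \bar R) : chart C ->
  measurable_fun setT (fun w => g (count C w)).
Proof.
move=> cC; case: PX => _ mX _ _.
by apply: (measurableT_comp _ (mX _ (chart_torus_borel cC))).
Qed.

Lemma prob_count C k : chart C ->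
  P [set w | count C w = k] =
  ((rate * area C) ^+ k / k`!%:R * expR (- (rate * area C)))%:E.
Proof.
move=> cC; case: PX => _ _ law _.
have := law _ (chart_torus_borel cC) [set k].
rewrite mes2_image; last by case: cC.
rewrite -/(area C) poisson_prob_set1; first exact.
by rewrite mulr_ge0 ?area_ge0// ltW.
Qed.

Lemma prob_counts m (C : 'I_m -> set (R * R)) (k : 'I_m -> nat) :
  (forall i, chart (C i)) -> trivIset setT C ->
  P (\bigcap_i [set w | count (C i) w = k i]) =
  (\prod_(i < m) P [set w | count (C i) w = k i])%E.
Proof.
move=> cC tC; case: PX => _ _ _ indep.
have := indep m (fun i => @torus_point R @` C i) _ _ k; apply.
  by move=> i; exact: chart_torus_borel.
apply/trivIsetP => i j _ _ ij; apply: torus_point_image_disjoint.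
- by case: (cC i).
- by case: (cC j).
- by move/trivIsetP : tC; apply.
Qed.

Lemma prob_count2 C D k l : chart C -> chart D -> C `&` D = set0 ->
  P ([set w | count C w = k] `&` [set w | count D w = l]) =
  (P [set w | count C w = k] * P [set w | count D w = l])%E.
Proof.
move=> cC cD CD.
have := @prob_counts 2 (fun i => if i == ord0 then C else D)
   (fun i => if i == ord0 then k else l) _ _.
rewrite !big_ord_recl big_ord0 mule1 /=.
have -> : \bigcap_(i in [set: 'I_2]) [set w |
     count (if i == ord0 then C else D) w = (if i == ord0 then k else l)] =
    [set w | count C w = k] `&` [set w | count D w = l].
  apply/seteqP; split => w /=.
    by move=> H; split; [exact: (H ord0 I)|exact: (H (lift ord0 ord0) I)].
  by move=> [wC wD] i _ /=; case: ifP.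
apply; first by move=> i; case: ifP.
apply/trivIsetP => i j _ _ ij; case: ifPn => i0; case: ifPn => j0 //.
- by move: ij; rewrite (eqP i0) (eqP j0) eqxx.
- by rewrite setIC.
- exfalso; move/eqP: ij; apply; apply/val_inj.
  by case: i j i0 j0 => -[|[|//]] //= ? [[|[|//]]].
Qed.

(** Disjointness makes the two counts independent; the second factor is the Poisson generating
    function, obtained by splitting according to the value of [count A]. *)
Lemma void_moment I A (t : R) : chart I -> chart A -> I `&` A = set0 -> 0 <= t ->
  (\int[P]_(w in [set w | count I w = 0%N]) (t ^+ count A w)%:E)%E =
  (expR (- (rate * area I)) * expR (rate * area A * (t - 1)))%:E.
Proof.
move=> cI cA IA t0; pose F k := [set w | count I w = 0%N] `&` [set w | count A w = k].
have -> : [set w | count I w = 0%N] = \bigcup_k F k.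
  rewrite /F -setI_bigcupr; apply/seteqP; split => [w /= w0|w [] //].
  by split => //; exists (count A w).
have mF k : measurable (F k) by apply: measurableI; exact: measurable_count_eq.
have mg := measurable_count_fun (fun n => (t ^+ n)%:E) cA.
have tF : trivIset setT F.
  apply/trivIsetP => i j _ _ ij; apply/seteqP; split => // w [[_ /= wi] [_ /= wj]].
  by move: ij; rewrite -wi -wj eqxx.
have g0 w : (\bigcup_k F k) w -> (0 <= (t ^+ count A w)%:E)%E by rewrite lee_fin exprn_ge0.
rewrite (ge0_integral_bigcup P mF (measurable_funS measurableT (@subsetT _ _) mg) g0 tF).
have intF k : (\int[P]_(w in F k) (t ^+ count A w)%:E)%E =
    ((expR (- (rate * area I)) * expR (- (rate * area A)))%:E *
     ((rate * area A * t) ^+ k / k`!%:R)%:E)%E.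
  transitivity (\int[P]_(x in F k) (cst (t ^+ k)%:E) x)%E.
    by apply: eq_integral => w /set_mem[_ /= ->].
  rewrite integral_cst//; transitivity ((t ^+ k)%:E * P (F k))%E => //.
  rewrite prob_count2// !prob_count// expr0 fact0 divr1 mul1r -!EFinM.
  congr EFin; rewrite [(_ * t) ^+ k]exprMn.
  move: (expR (- (rate * area I))) (expR (- (rate * area A))) => x y.
  move: ((rate * area A) ^+ k) (t ^+ k) (k`!%:R^-1) => r s f; ring.
under eq_eseriesr => k _ do rewrite intF.
have ra0 : 0 <= rate * area A * t by rewrite !mulr_ge0 ?area_ge0//; exact: ltW.
rewrite nneseriesZl; last first.
  by move=> k _; rewrite lee_fin divr_ge0// exprn_ge0.
by rewrite expR_nneseries// -EFinM -!expRD; congr (expR _)%:E; ring.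
Qed.

End PoissonCounts.

(** * Upper bound *)

Section FiniteCounting.
Set Implicit Arguments. Unset Strict Implicit.

Lemma card_fset_set_le (T : choiceType) (A B : set T) : finite_set B -> A `<=` B ->
  (#|` fset_set A| <= #|` fset_set B|)%N.
Proof.
move=> fB AB; apply: fsubset_leq_card; rewrite -fset_set_sub//.
exact: sub_finite_set fB.
Qed.

Lemma card_fset_set_bigU (T : choiceType) (I : eqType) (r : seq I) (G : I -> set T) (A : set T) :
  (forall q, finite_set (G q)) -> (forall x, A x -> exists2 q, q \in r & G q x) ->
  (#|` fset_set A| <= \sum_(q <- r) #|` fset_set (G q)|)%N.
Proof.
move=> fG; elim: r A => [|q r IH] A AG.
  rewrite big_nil; have -> : A = set0 by apply/seteqP; split => // x /AG[].
  by rewrite fset_set0 cardfs0.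
have fGr : finite_set (\bigcup_(p in [set` r]) G p) by exact: bigcup_finite.
rewrite big_cons; have AS : A `<=` G q `|` (A `&` \bigcup_(p in [set` r]) G p).
  move=> x Ax; have [p] := AG x Ax; rewrite inE => /orP[/eqP ->|pr] Gpx; first by left.
  by right; split => //; exists p.
have fA' : finite_set (A `&` \bigcup_(p in [set` r]) G p).
  by apply: sub_finite_set fGr => x [].
apply: leq_trans (card_fset_set_le _ AS) _; first by rewrite finite_setU.
have {}IH : (#|` fset_set (A `&` \bigcup_(p in [set` r]) G p)| <=
    \sum_(p <- r) #|` fset_set (G p)|)%N.
  by apply: IH => x [_ [p pr Gpx]]; exists p.
by rewrite fset_setU// cardfsU; apply: leq_trans (leq_subr _ _) _; rewrite leq_add2l.
Qed.

Lemma card_fset_setX (T U : choiceType) (A : set T) (B : set U) : finite_set A -> finite_set B ->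
  (#|` fset_set (A `*` B)| <= #|` fset_set A| * #|` fset_set B|)%N.
Proof.
move=> fA fB; rewrite fset_setX// -(size_allpairs pair); apply: uniq_leq_size => //.
move=> [x y]; rewrite in_fsetM => /andP[/= xA yB]; exact: allpairs_f.
Qed.

Lemma card_fset_set_image (T U : choiceType) (f : T -> U) (A : set T) : finite_set A ->
  (#|` fset_set (f @` A)| <= #|` fset_set A|)%N.
Proof. by move=> fA; rewrite fset_set_image//; exact: leq_imfset_card. Qed.

End FiniteCounting.

Section UpperBound.
Set Implicit Arguments. Unset Strict Implicit.
Context {R : realType}.
Local Notation E4 := 'rV[R]_4.

Definition levels (L : nat) : seq (nat * nat) :=
  [seq (i, i') | i <- iota 0 L.+1, i' <- iota 0 (L - i).+1].

Definition cells (a : nat * nat) : seq (nat * nat) :=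
  [seq (j, j') | j <- iota 0 (2 ^ a.1), j' <- iota 0 (2 ^ a.2)].

Definition boxes (L : nat) : seq ((nat * nat) * (nat * nat)) :=
  [seq (a, b) | a <- levels L, b <- cells a].

Definition cell (q : (nat * nat) * (nat * nat)) : set (R * R) :=
  arc q.1.1 q.2.1 `*` arc q.1.2 q.2.2.

Definition wide_cell (q : (nat * nat) * (nat * nat)) : set (R * R) :=
  wide_arc q.1.1 q.2.1 `*` wide_arc q.1.2 q.2.2.

(* At the finest levels [i + i' = L] no part of the box is required to be empty. *)
Definition void_part L (q : (nat * nat) * (nat * nat)) : set (R * R) :=
  if (q.1.1 + q.1.2 < L)%N then cell q else set0.

Lemma mem_boxes L i i' j j' : (i + i' <= L)%N -> (j < 2 ^ i)%N -> (j' < 2 ^ i')%N ->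
  ((i, i'), (j, j')) \in boxes L.
Proof.
move=> iL ji ji'; apply/allpairsPdep; exists (i, i'), (j, j'); split => //.
  by apply/allpairsPdep; exists i, i'; split => //; rewrite mem_iota; lia.
by apply/allpairsPdep; exists j, j'; split => //; rewrite mem_iota.
Qed.

Lemma boxesP L q : q \in boxes L ->
  [/\ (q.1.1 + q.1.2 <= L)%N, (q.2.1 < 2 ^ q.1.1)%N & (q.2.2 < 2 ^ q.1.2)%N].
Proof.
move=> /allpairsPdep[a [b [aL bc ->]]]; move: aL bc.
move=> /allpairsPdep[i [i' [iL iL' ->]]] /allpairsPdep[j [j' [jL jL' ->]]].
by move: iL iL' jL jL'; rewrite !mem_iota /= => iL iL' jL jL'; split; rewrite //; lia.
Qed.

(** A facet is charged to a box whose wide cell contains all tight points of a supporting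
    hyperplane; it is then the [flat_section] of a quadruple of these points. *)
Lemma number_of_facets_le L (S : set E4) :
  finite_set S -> S `<=` @clifford_torus R -> has_affine_dim 4 (conv_hull S) ->
  (#|` fset_set (faces 3 (conv_hull S))| <= \sum_(q <- boxes L)
    if #|` fset_set (S `&` @torus_point R @` void_part L q)| == 0
    then #|` fset_set (S `&` @torus_point R @` wide_cell q)| ^ 4 else 0)%N.
Proof.
move=> finS ST dim4.
pose Y q := S `&` @torus_point R @` wide_cell q.
have fY q : finite_set (Y q) by apply: sub_finite_set finS => x [].
have fv q : finite_set (S `&` @torus_point R @` void_part L q).
  by apply: sub_finite_set finS => x [].
pose G q := if #|` fset_set (S `&` @torus_point R @` void_part L q)| == 0%N
  then flat_section (conv_hull S) @` (Y q `*` Y q `*` Y q `*` Y q) else set0.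
have fY4 q : finite_set (Y q `*` Y q `*` Y q `*` Y q).
  by apply: finite_setX => //; apply: finite_setX => //; exact: finite_setX.
have fG q : finite_set (G q) by rewrite /G; case: ifP => // _; exact: finite_image.
apply: leq_trans (card_fset_set_bigU (r := boxes L) fG _) _; last first.
  apply: leq_sum => q _; rewrite /G; case: ifP => _; last by rewrite fset_set0 cardfs0.
  apply: leq_trans (card_fset_set_image _ (fY4 q)) _.
  apply: leq_trans (card_fset_setX _ (fY q)) _; first by do 2 apply: finite_setX => //.
  rewrite expnSr leq_mul2r; apply/orP; right.
  apply: leq_trans (card_fset_setX _ (fY q)) _; first by apply: finite_setX => //.
  rewrite expnSr leq_mul2r; apply/orP; right.
  exact: card_fset_setX.
move=> F /(facet_flat_section finS dim4)[c [b [c0 Sb [p0 [p1 [p2 [p3 /= [T0 T1 T2 T3 ->]]]]]]]].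
have [Sp0 bp0] := T0.
have [i [i' [j [j' [iL ji ji' void tight]]]]] := tight_points_in_wide_cell L c0 ST Sb Sp0 bp0.
exists ((i, i'), (j, j')); first exact: mem_boxes.
rewrite /G ifT; last first.
  rewrite /void_part /=; case: ifP => [iLt|_]; last by rewrite image_set0 setI0 fset_set0 cardfs0.
  by have := void iLt; rewrite /torus_rect /cell /= => ->; rewrite fset_set0 cardfs0.
have TY x : S x /\ dot c x = b -> Y ((i, i'), (j, j')) x.
  by move=> [Sx xb]; split => //; exact: tight.
by exists (p0, p1, p2, p3) => //; do 3 (split; last exact: TY); exact: TY.
Qed.

(** From [n * x <= (1 + x) ^ n] follows [n ^ 4 <= x ^ (- 4) * ((1 + x) ^ 4) ^ n], and
    [(1 + x) ^ 4 <= 1 + 15 * x] for [x <= 1], whence [x = e / 15]. *)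
Lemma power4_exp_bound (e : R) : 0 < e -> e <= 1 ->
  exists C t, [/\ 0 < C, 1 <= t, t <= 1 + e & forall n, (n ^ 4)%N%:R <= C * t ^+ n].
Proof.
move=> e0 e1; pose x := e / 15; have x0 : 0 < x by rewrite /x; lra.
have x1 : x <= 1 by rewrite /x; lra.
exists (x^-1 ^+ 4), ((1 + x) ^+ 4); split.
- by rewrite exprn_gt0// invr_gt0.
- by rewrite exprn_ege1//; lra.
- rewrite (_ : 1 + e = 1 + 15 * x); last by rewrite /x; field.
  have pw k : x ^+ k.+1 <= x by rewrite exprS ger_pMr// exprn_ile1// ltW.
  have := pw 1%N; have := pw 2%N; have := pw 3%N.
  rewrite (_ : (1 + x) ^+ 4 = 1 + 4 * x + 6 * x ^+ 2 + 4 * x ^+ 3 + x ^+ 4); last by ring.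
  lra.
- move=> n; rewrite natrX -exprM mulnC exprM -exprMn; apply: lerXn2r => //; rewrite ?nnegrE//.
    by rewrite mulr_ge0 ?invr_ge0 ?exprn_ge0 ?(ltW x0)//; lra.
  rewrite mulrC ler_pdivlMr//; elim: n => [|n IH]; first by rewrite mul0r expr0.
  have : 1 <= (1 + x) ^+ n by rewrite exprn_ege1//; lra.
  rewrite -natr1 exprS; nra.
Qed.

Lemma chart_set0 : chart (@set0 (R * R)).
Proof.
have -> : set0 = \bigcup_(n in @set0 nat) (@set0 (R * R)) by rewrite bigcup_set0.
by apply: chart_bigcup.
Qed.

Lemma area_set0 : area (@set0 (R * R)) = 0.
Proof. by rewrite /area measure0. Qed.

Section Process.
Context {d : measure_display} {Omega : measurableType d}.
Variables (P : probability Omega R) (rate : R) (X : Omega -> set 'rV[R]_4).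
Hypothesis rate_gt0 : 0 < rate.
Hypothesis PX : poisson_process P rate X.

Lemma count_eq0 C w : count X C w = 0%N -> X w `&` @torus_point R @` C = set0.
Proof.
move=> /eqP; rewrite /count /num_points cardfs_eq0 => /eqP.
apply: fset_set_set0.
by case: PX => /(_ w)[fX _] _ _ _; apply: sub_finite_set fX => x [].
Qed.

(** When [I] is empty of points, the counts of [Q] and of [Q] minus [I] agree, and the latter is
    independent of the emptiness; this replaces any joint moment of dependent counts. *)
Lemma power4_moment_le (C t : R) I Q : 0 <= C -> 1 <= t ->
  (forall n, (n ^ 4)%N%:R <= C * t ^+ n) -> chart I -> chart Q ->
  (\int[P]_w (if count X I w == 0%N then count X Q w ^ 4 else 0)%N%:R%:E <=
   (C * (expR (- (rate * area I)) * expR (rate * area Q * (t - 1))))%:E)%E.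
Proof.
move=> C0 t1 Ct cI cQ.
have t0 : 0 <= t by lra.
have cQI := chartD cQ cI.
pose D := [set w | count X I w = 0%N].
have mD : measurable D by exact: (measurable_count_eq PX).
pose g w := (C%:E * (t ^+ count X (Q `\` I) w)%:E)%E.
have g0 w : (0 <= (t ^+ count X (Q `\` I) w)%:E)%E by rewrite lee_fin exprn_ge0.
apply: (@le_trans _ _ (\int[P]_w (g \_ D) w)%E).
  apply: le_integral_nonmeasurable => w; first by rewrite lee_fin.
  rewrite patchE; case: ifPn => [/eqP w0|wI]; last by case: ifP => // _; rewrite mule_ge0.
  rewrite mem_set// /g -EFinM lee_fin; have -> // : count X Q w = count X (Q `\` I) w.
  rewrite /count /num_points; congr (#|` fset_set _|).
  have := count_eq0 w0 => /seteqP[XI _].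
  apply/seteqP; split => x [Xx [u uQ ux]]; split => //; exists u => //; last by case: uQ.
  by split => // uI; apply: (XI x); split => //; exists u.
rewrite -integral_mkcond ge0_integralZl//; last first.
  apply: (measurable_funS measurableT) => //.
  exact: (measurable_count_fun PX (fun n => (t ^+ n)%:E) cQI).
have IQ : I `&` (Q `\` I) = set0 by apply/seteqP; split => // u [uI [_]].
have -> := void_moment rate_gt0 PX cI cQI IQ t0.
rewrite -EFinM lee_fin; apply: (ler_wpM2l C0); apply: (ler_wpM2l (expR_ge0 _)).
rewrite ler_expR; apply: ler_wpM2r; first by rewrite subr_ge0.
by apply: (ler_wpM2l (ltW rate_gt0)); apply: area_le => // u [].
Qed.

End Process.

Lemma sum_pow4_le n : (\sum_(0 <= i < n.+1) 4 ^ i <= 2 * 4 ^ n)%N.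
Proof.
elim: n => [|n IH]; first by rewrite big_nat1.
by rewrite big_nat_recr//= expnS; lia.
Qed.

(** For fixed [i] the geometric sum over [i'] is at most twice its last term, which is [4 ^ L]
    whatever [i] is. The [L + 1] values of [i] are the source of the logarithm. *)
Lemma sum_levels_le L : (\sum_(a <- levels L) 4 ^ (a.1 + a.2) <= L.+1 * (2 * 4 ^ L))%N.
Proof.
rewrite /levels big_allpairs_dep -[iota 0 L.+1]/(index_iota 0 L.+1).
apply: (@leq_trans (\sum_(0 <= i < L.+1) 2 * 4 ^ L)%N); last first.
  by rewrite sum_nat_const_nat subn0.
rewrite !big_seq; apply: leq_sum => i; rewrite mem_index_iota => /andP[_ iL].
have -> : (\sum_(i' <- iota 0 (L - i).+1) 4 ^ ((i, i').1 + (i, i').2) =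
    4 ^ i * \sum_(0 <= i' < (L - i).+1) 4 ^ i')%N.
  by rewrite big_distrr /= /index_iota subn0; apply: eq_bigr => i' _; rewrite expnD.
apply: leq_trans (leq_mul (leqnn _) (sum_pow4_le (L - i))) _.
by rewrite mulnCA -expnD subnKC.
Qed.

(** The constant is chosen before the probability space, which may vary with the rate. *)
Lemma expected_facets_upper : exists2 C : R, 0 < C &
  forall (d : measure_display) (Omega : measurableType d) (P : probability Omega R)
    (rate : R) (X : Omega -> set E4) (L : nat),
  2 ^+ L <= rate -> rate < 2 ^+ L.+1 -> poisson_process P rate X ->
  ('E_P[fun w => (f3 (conv_hull (X w)))%:R] <= (2 + C * L.+1%:R * rate)%:E)%E.
Proof.
(* Here [1458 = 2 * 729]: the wide cell has at most 729 times the area of the cell, so the factor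
   [t - 1] reduces its exponent to half that of the void probability. *)
have [C [t [C0 t1 te Ct]]] : exists C t : R, [/\ 0 < C, 1 <= t, t <= 1 + 1458^-1 &
    forall n, (n ^ 4)%N%:R <= C * t ^+ n].
  by apply: power4_exp_bound; lra.
exists (2 * (C * (2 * expR 64))); first by rewrite !mulr_gt0// expR_gt0.
move=> d Omega P rate X L rL rL1 PX.
have r0 : 0 < rate by apply: lt_le_trans rL; rewrite exprn_gt0.
(* Testing membership makes [W q] measurable for every index [q], as the sum of integrals
   requires. *)
pose W q w := (if (q \in boxes L) && (count X (void_part L q) w == 0%N)
  then count X (wide_cell q) w ^ 4 else 0)%N.
have pi0 := pi_gt0 R; have pi2 := pi_ge2 R; have pi4 : pi < 4 :> R by have := pihalf_lt2 R; lra.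
have vchart q : q \in boxes L -> chart (void_part L q).
  move=> /boxesP[_ j2 j2']; rewrite /void_part; case: ifP => _; last exact: chart_set0.
  exact: arc_chart.
have IW q : q \in boxes L -> (\int[P]_w ((W q w)%:R%:E) <=
    (C * (2 * expR 64) * 2 ^+ (q.1.1 + q.1.2) / rate)%:E)%E.
  move=> qL; rewrite /W qL /=; have cI := vchart _ qL.
  have cQ : chart (wide_cell q) by exact: wide_arc_chart.
  apply: le_trans (power4_moment_le r0 PX (ltW C0) t1 Ct cI cQ) _.
  rewrite lee_fin -!mulrA ler_wpM2l ?(ltW C0)// -expRD.
  set m := (q.1.1 + q.1.2)%N.
  have llE : arc_length q.1.1 * arc_length q.1.2 = 4 * pi ^+ 2 / 2 ^+ m :> R.
    by rewrite /arc_length /m exprD; field; rewrite !expf_neq0.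
  have m0 : 0 < 2 ^+ m :> R by rewrite exprn_gt0.
  set a := arc_length q.1.1 * arc_length q.1.2 in llE.
  have a0 : 0 < a by rewrite mulr_gt0// arc_length_gt0.
  have aQ : rate * area (wide_cell q) * (t - 1) <= rate * a / 2.
    apply: (@le_trans _ _ (rate * (729 * a) * 1458^-1)); last first.
      by rewrite le_eqVlt; apply/orP; left; apply/eqP; field.
    apply: ler_pM; [by rewrite mulr_ge0 ?area_ge0// ltW|by rewrite subr_ge0| |by rewrite lerBlDl].
    by rewrite ler_wpM2l ?(ltW r0)//; exact: area_wide_arc.
  have e1 : 1 <= expR 64 :> R by have := @expR_ge1Dx R 64; lra.
  have [mL|mL] := ltnP m L.
    have aI : area (void_part L q) = a.
      by have [_ j2 j2'] := boxesP qL; rewrite /void_part ifT// /cell area_arc.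
    rewrite aI; have x0 : 0 < rate * a / 2 by rewrite divr_gt0// mulr_gt0.
    (* The weak bound [exp (- x) <= 1 / x] suffices: it leaves [2 ^ m / rate] per cell, and the
       levels [m < L] still sum geometrically. *)
    apply: (@le_trans _ _ (expR (- (rate * a / 2)))).
      by rewrite ler_expR; lra.
    apply: (@le_trans _ _ (rate * a / 2)^-1).
      rewrite expRN lef_pV2 ?posrE ?expR_gt0//.
      by have := expR_ge1Dx (rate * a / 2); lra.
    have -> : (rate * a / 2)^-1 = (2 ^+ m / rate) / (2 * pi ^+ 2).
      have inv_half (p y r : R) : p != 0 -> y != 0 -> r != 0 ->
          (r * (4 * p ^+ 2 / y) / 2)^-1 = (y / r) / (2 * p ^+ 2).
        by move=> p_neq0 y_neq0 r_neq0; field; rewrite p_neq0 r_neq0 y_neq0.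
      by rewrite llE inv_half// gt_eqF.
    have y0 : 0 < 2 ^+ m / rate by rewrite divr_gt0.
    rewrite ler_pdivrMr; last by rewrite mulr_gt0// exprn_gt0//; lra.
    rewrite -[X in X <= _]mul1r -!mulrA mulrCA.
    have -> : 2 * (expR 64 * (2 ^+ m * (rate^-1 * (2 * pi ^+ 2)))) =
      (2 ^+ m / rate) * (4 * (expR 64 * pi ^+ 2)) by ring.
    have p1 : 1 <= pi ^+ 2 :> R by rewrite exprn_ege1//; lra.
    have : 1 <= expR 64 * pi ^+ 2 :> R by nra.
    rewrite mulrC; nra.
  have mE : m = L by apply/eqP; rewrite eqn_leq mL andbT; have [] := boxesP qL.
  (* At level [L] nothing is required to be empty, but [rate < 2 ^ (L + 1)] and [pi < 4] bound the
     exponent by [4 * pi ^ 2 <= 64]. *)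
  apply: (@le_trans _ _ (expR 64)).
    rewrite ler_expR /void_part -/m ltnNge mL /= area_set0 mulr0 oppr0 add0r.
    rewrite mulrA; apply: (le_trans aQ); rewrite llE mE.
    have half (p y r : R) : r * (4 * p / y) / 2 = (r / y) * (2 * p) by lra.
    rewrite half.
    have : rate / 2 ^+ L <= 2 by rewrite ler_pdivrMr ?exprn_gt0// -exprS ltW.
    have : 0 <= rate / 2 ^+ L by rewrite divr_ge0 ?exprn_ge0// ltW.
    have : pi ^+ 2 <= 16 :> R by rewrite expr2; nra.
    have : 0 <= pi ^+ 2 :> R by rewrite sqr_ge0.
    nra.
  rewrite mE; have : 1 <= 2 * (2 ^+ L / rate) by rewrite mulrA -exprS ler_pdivlMr// mul1r ltW.
  by set y := 2 ^+ L / rate; nra.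
rewrite unlock.
(* The summand 2 covers the convention for 3-simplices, where no charging takes place. *)
apply: (@le_trans _ _ (\int[P]_w (2%:E + \sum_(q <- boxes L) (W q w)%:R%:E))%E).
  apply: le_integral_nonmeasurable => w; first by rewrite lee_fin.
  rewrite sumEFin -EFinD lee_fin -natr_sum -natrD ler_nat /f3.
  case: ifPn => [/asboolP dim4|_]; last first.
    by case: ifP => _ //; rewrite -[X in (X <= _)%N]addn0 leq_add.
  case: PX => /(_ w)[fX XT] _ _ _.
  apply: leq_trans (number_of_facets_le L fX XT dim4) _.
  apply: leq_trans (leq_addl _ _); rewrite big_seq [leqRHS]big_seq.
  by apply: leq_sum => q qL; rewrite /W qL.
have mW q : measurable_fun setT (fun w => (W q w)%:R%:E : \bar R).
  rewrite /W; case: (boolP (q \in boxes L)) => qL /=; last exact: measurable_cst.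
  apply: (eq_measurable_fun (fun w =>
    ((count X (void_part L q) w == 0%N)%:R%:E * (count X (wide_cell q) w ^ 4)%N%:R%:E)%E)).
    by move=> w _; case: ifP => _; rewrite ?mul1e ?mul0e.
  apply: emeasurable_funM.
    exact: (measurable_count_fun PX (fun n => (n == 0%N)%:R%:E) (vchart _ qL)).
  exact: (measurable_count_fun PX (fun n => (n ^ 4)%N%:R%:E) (wide_arc_chart _ _ _ _)).
have W0 q w : (0 <= (W q w)%:R%:E :> \bar R)%E by rewrite lee_fin.
have int2 : (\int[P]_w (2%:E : \bar R) = 2%:E)%E.
  by have := expectation_cst P 2; rewrite unlock.
rewrite ge0_integralD//; [|by move=> w _; rewrite sume_ge0//|exact: emeasurable_sum].
rewrite int2 ge0_integral_sum// [leRHS]EFinD; apply: leeD => //.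
apply: (@le_trans _ _ (\sum_(q <- boxes L) (C * (2 * expR 64) * 2 ^+ (q.1.1 + q.1.2) / rate)%:E)%E).
  by rewrite big_seq [leRHS]big_seq; apply: lee_sum => q qL; exact: IW.
rewrite sumEFin lee_fin.
have pow4 n : (4 ^ n)%N%:R = 2 ^+ n * 2 ^+ n :> R by rewrite natrX -exprMn -natrM.
have -> : \sum_(q <- boxes L) (C * (2 * expR 64) * 2 ^+ (q.1.1 + q.1.2) / rate) =
    C * (2 * expR 64) / rate * (\sum_(a <- levels L) 4 ^ (a.1 + a.2))%N%:R.
  rewrite /boxes big_allpairs_dep natr_sum mulr_sumr; apply: eq_bigr => a _ /=.
  rewrite big_const_seq count_predT iter_addr_0 size_allpairs !size_iota -expnD.
  by rewrite -[LHS]mulr_natr pow4 natrX; ring.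
have D0 : 0 < C * (2 * expR 64) by rewrite !mulr_gt0// expR_gt0.
have L4 : (4 ^ L)%:R <= rate * rate.
  by rewrite pow4 ler_pM// exprn_ge0.
apply: (@le_trans _ _ (C * (2 * expR 64) / rate * (L.+1%:R * (2 * (rate * rate))))).
  rewrite ler_wpM2l//; first by rewrite divr_ge0// ltW.
  apply: (@le_trans _ _ (L.+1 * (2 * 4 ^ L))%N%:R); first by rewrite ler_nat sum_levels_le.
  by rewrite !natrM ler_wpM2l// ler_wpM2l//.
rewrite le_eqVlt; apply/orP; left; apply/eqP; field; exact: lt0r_neq0.
Qed.

End UpperBound.

(** * Lower bound *)

Section TipGeometry.
Set Implicit Arguments. Unset Strict Implicit.
Context {R : realType}.
Local Notation E4 := 'rV[R]_4.

(** At [1 / 2] this comes from [2 * cos (1 / 2) ^ 2 - 1 = cos 1 > 0]. *)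
Lemma cos_ge_half (x : R) : 0 <= x -> x <= 1 / 2 -> 1 / 2 <= cos x.
Proof.
move=> x0 x2; have pi2 := pi_ge2 R.
apply: (@le_trans _ _ (cos (1 / 2))); last first.
  have := @ltr_cos R x (1 / 2); rewrite !in_itv/= => H.
  move: x2; rewrite le_eqVlt => /orP[/eqP ->//|x2].
  by apply: ltW; rewrite H//; apply/andP; split; lra.
have : 0 < cos (1 / 2 *+ 2 : R).
  by have -> : 1 / 2 *+ 2 = 1 :> R by [field]; exact: cos1_gt0.
rewrite cos_mulr2n.
have : 0 <= cos (1 / 2 : R) by rewrite cos_ge0_pihalf//; apply/andP; split; lra.
nra.
Qed.

Lemma sin_MVT (x : R) : 0 < x -> exists2 y, 0 < y < x & sin x = x * cos y.
Proof.
move=> x0; have ds y : y \in `]0, x[ -> is_derive y 1 sin (cos y).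
  by move=> _; exact: is_derive_sin.
have cs : {within `[0, x], continuous (@sin R)}.
  by apply: continuous_subspaceT => y; exact: continuous_sin.
have [y] := MVT x0 ds cs; rewrite in_itv/= sin0 !subr0 => yx ->.
by exists y => //; rewrite mulrC.
Qed.

Lemma sin_ge_half (x : R) : 0 < x -> x <= 1 / 2 -> x / 2 <= sin x.
Proof.
move=> x0 x2; have [y /andP[y0 yx] ->] := sin_MVT x0.
have := @cos_ge_half y; nra.
Qed.

Lemma abs_sin_le (x : R) : `|sin x| <= `|x|.
Proof.
have pos y : 0 < y -> `|sin y| <= y :> R.
  move=> y0; have [z _ ->] := sin_MVT y0.
  by rewrite normrM (ger0_norm (ltW y0)) ger_pMr// cos_max.
have [x0|x0|->] := ltgtP x 0; last by rewrite sin0.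
  by rewrite -[sin x]opprK normrN -sinN -[ `|x|]normrN; apply: le_trans (pos _ _) _;
    rewrite ?oppr_gt0// ler_norm.
by apply: le_trans (pos _ x0) _; rewrite ler_norm.
Qed.

(** [nsin] and [nversin] are normalized to be 1 at [x = p]. For small angles they resemble [x / p]
    and [(x / p) ^ 2], so estimates relative to [p] are uniform in the size of the box. *)
Definition nsin (p x : R) : R := sin x / sin p.
Definition nversin (p x : R) : R := (1 - cos x) / (1 - cos p).

Lemma versin_half (x : R) : 1 - cos x = 2 * sin (x / 2) ^+ 2.
Proof.
have -> : cos x = cos ((x / 2) *+ 2) by rewrite -mulr_natr divfK.
by rewrite cos_mulr2n cos2sin2; ring.
Qed.

Lemma sin_half (x : R) : sin x = 2 * (sin (x / 2) * cos (x / 2)).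
Proof.
have -> : sin x = sin ((x / 2) *+ 2) by rewrite -mulr_natr divfK.
by rewrite sin_mulr2n mulr2n; ring.
Qed.

Lemma nversinE p x : nversin p x = nsin (p / 2) (x / 2) ^+ 2.
Proof.
rewrite /nversin !versin_half /nsin expr_div_n.
by rewrite -mulf_div divff ?mul1r.
Qed.

Lemma nsinN p x : nsin p (- x) = - nsin p x.
Proof. by rewrite /nsin sinN mulNr. Qed.

Lemma nversinN p x : nversin p (- x) = nversin p x.
Proof. by rewrite /nversin cosN. Qed.

Lemma nversin_ge0 p x : 0 <= nversin p x.
Proof. by rewrite nversinE sqr_ge0. Qed.

Lemma nsin_near0 p x (e : R) : 0 < p -> p <= 1 / 6 -> 0 <= e -> `|x| <= e * p ->
  `|nsin p x| <= 2 * e.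
Proof.
move=> p0 p6 e0 xe; rewrite /nsin.
have sp : p / 2 <= sin p by apply: sin_ge_half => //; lra.
have sp0 : 0 < sin p by lra.
rewrite normrM normfV (gtr0_norm sp0) ler_pdivrMr//.
have := abs_sin_le x; nra.
Qed.

Lemma nsin_near1 p x (e : R) : 0 < p -> p <= 1 / 6 -> 0 <= e -> e <= 1 ->
  `|x - p| <= e * p -> `|nsin p x - 1| <= 3 * e.
Proof.
move=> p0 p6 e0 e1 xe.
have sp : p / 2 <= sin p by apply: sin_ge_half => //; lra.
have sp0 : 0 < sin p by lra.
(* Addition formula for [x = p + (x - p)]: the first term is linear in the small deviation, the
   second quadratic. *)
have E : nsin p x - 1 = cos p * nsin p (x - p) - (1 - cos (x - p)).
  rewrite /nsin -{1}(subrK p x) sinD; field; exact: lt0r_neq0.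
have n1 : `|cos p * nsin p (x - p)| <= 2 * e.
  rewrite normrM; apply: le_trans (nsin_near0 p0 p6 e0 xe).
  by rewrite ler_piMl// cos_max.
have n2 : `|1 - cos (x - p)| <= e.
  rewrite ger0_norm ?subr_ge0 ?cos_le1// versin_half -[sin _ ^+ 2]real_normK ?num_real//.
  have : `|sin ((x - p) / 2)| <= e * p / 2.
    apply: le_trans (abs_sin_le _) _; rewrite normrM [ `|2^-1|]ger0_norm//; lra.
  have := normr_ge0 (sin ((x - p) / 2)); set s := `|sin _| => s0 se.
  have : e * p / 2 <= e / 12 by nra.
  move=> ep; have s12 : s <= e / 12 by lra.
  by rewrite expr2; nra.
rewrite E; apply: le_trans (ler_normB _ _) _; lra.
Qed.

Lemma nversin_near0 p x (e : R) : 0 < p -> p <= 1 / 6 -> 0 <= e -> e <= 1 / 6 ->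
  `|x| <= e * p -> `|nversin p x| <= e.
Proof.
move=> p0 p6 e0 e1 xe; rewrite ger0_norm ?nversin_ge0// nversinE.
have := @nsin_near0 (p / 2) (x / 2) e; rewrite normrM [ `|2^-1|]ger0_norm// => H.
have : `|nsin (p / 2) (x / 2)| <= 2 * e by apply: H => //; lra.
rewrite ler_norml => /andP[h1 h2]; rewrite expr2; nra.
Qed.

Lemma nversin_near1 p x (e : R) : 0 < p -> p <= 1 / 6 -> 0 <= e -> e <= 1 / 9 ->
  `|x - p| <= e * p -> `|nversin p x - 1| <= 7 * e.
Proof.
move=> p0 p6 e0 e1 xe; rewrite nversinE.
have : `|nsin (p / 2) (x / 2) - 1| <= 3 * e.
  apply: nsin_near1 => //; try lra.
  by rewrite -mulrBl normrM [ `|2^-1|]ger0_norm//; lra.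
rewrite !ler_norml => /andP[h1 h2]; rewrite expr2; apply/andP; split; nra.
Qed.

(** With [s = |nsin (p / 2) (x / 2)|], the half-angle formulas give [|nsin p x| <= 2 * s] and
    [nversin p x = s ^ 2]. So the odd terms of a functional are controlled by the even ones on the
    whole circle. *)
Lemma nsin_le p x : 0 < p -> p <= 1 / 6 -> `|nsin p x| <= 1 + nversin p x.
Proof.
move=> p0 p6; rewrite nversinE.
have cp : 1 / 2 <= cos (p / 2) by apply: cos_ge_half; lra.
have sp : p / 2 <= sin p by apply: sin_ge_half => //; lra.
have sp2 : p / 2 / 2 <= sin (p / 2) by apply: sin_ge_half; lra.
have E : nsin p x = nsin (p / 2) (x / 2) * (cos (x / 2) / cos (p / 2)).
  have alg (a b a' b' : R) : a' != 0 -> b' != 0 ->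
      2 * (a * b) / (2 * (a' * b')) = a / a' * (b / b').
    by move=> a0 b0; field; rewrite a0 b0.
  rewrite /nsin (sin_half x) (sin_half p) alg//; rewrite gt_eqF//; lra.
have c2 : `|cos (x / 2) / cos (p / 2)| <= 2.
  rewrite normrM normfV (@gtr0_norm _ (cos (p / 2))); last lra.
  rewrite ler_pdivrMr; last lra.
  by have := cos_max (x / 2); lra.
rewrite E normrM; have := normr_ge0 (nsin (p / 2) (x / 2)).
rewrite -[nsin (p / 2) (x / 2) ^+ 2]real_normK ?num_real//.
set s := `|nsin _ _|; have := normr_ge0 (cos (x / 2) / cos (p / 2)).
set z := `|_ / _| in c2 * => z0 s0.
have : s * z <= s * 2 by rewrite ler_wpM2l.
have := sqr_ge0 (s - 1); rewrite !expr2; nra.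
Qed.

(** At [2 * p] the versine has at least doubled: [1 - cos (2 * p) = 2 * (1 - cos p) * (1 + cos p)].
    The gap between 1 at the tips and 2 here absorbs all perturbations. *)
Lemma nversin_far p x : 0 < p -> p <= 1 / 6 -> 2 * p <= `|x| -> `|x| <= 2 * pi - 2 * p ->
  2 <= nversin p x.
Proof.
move=> p0 p6 xp xpi; have pi2 := pi_ge2 R.
have cp : 1 / 2 <= cos p by apply: cos_ge_half; lra.
have sp : p / 2 / 2 <= sin (p / 2) by apply: sin_ge_half; lra.
have c1 : 0 < 1 - cos p.
  by rewrite versin_half; have : 0 < sin (p / 2) by [lra]; nra.
rewrite /nversin ler_pdivlMr//.
have : cos x <= cos (p *+ 2).
  rewrite -cos_norm; have [xl|xl] := leP `|x| pi.
    move: xp; rewrite le_eqVlt => /orP[/eqP <-|xp]; first by rewrite mulr_natl.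
    apply: ltW; rewrite -mulr_natl ltr_cos// in_itv/=; apply/andP; split; lra.
  have -> : cos `|x| = cos (2 * pi - `|x|).
    rewrite (_ : 2 * pi - `|x| = - `|x| + pi *+ 2) ?cosD2pi ?cosN//.
    by rewrite mulr_natl addrC.
  move: xpi; rewrite le_eqVlt => /orP[/eqP ->|xpi].
    by rewrite opprB [2 * pi + _]addrC subrK mulr_natl.
  by apply: ltW; rewrite -mulr_natl ltr_cos ?in_itv/=; try (apply/andP; split); lra.
rewrite cos_mulr2n => H.
have : cos p <= 1 := cos_le1 p.
move: H; rewrite expr2; nra.
Qed.


End TipGeometry.

(** * Four perturbed tips of an ellipse span a facet *)

Section TipFacets.
Set Implicit Arguments. Unset Strict Implicit.
Context {R : realType}.
Local Notation E4 := 'rV[R]_4.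

(* Row [i] lists the limit values of the four coordinate functions ([nversin] and
   [nsin] in each of the two angles) at the tips [(p, 0)], [(- p, 0)], [(0, q)],
   [(0, - q)] of an ellipse. *)
Definition tip_matrix : 'M[R]_4 := \matrix_(i, j) nth 0
  (nth [::] [:: [:: 1; 1; 0; 0]; [:: 1; -1; 0; 0]; [:: 0; 0; 1; 1]; [:: 0; 0; 1; -1]] i) j.

Lemma perturbed_product (k a b c d x y z t x0 y0 z0 t0 : R) :
  `|x - x0| <= k -> `|y - y0| <= k -> `|z - z0| <= k -> `|t - t0| <= k ->
  `|(x * a + y * b + z * c + t * d) - (x0 * a + y0 * b + z0 * c + t0 * d)| <=
  k * (`|a| + `|b| + `|c| + `|d|).
Proof.
move=> hx hy hz ht.
have -> : (x * a + y * b + z * c + t * d) - (x0 * a + y0 * b + z0 * c + t0 * d) =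
  (x - x0) * a + (y - y0) * b + (z - z0) * c + (t - t0) * d by ring.
have B (r s : R) : `|r| <= k -> `|r * s| <= k * `|s|.
  by move=> rs; rewrite normrM ler_wpM2r.
have := B _ a hx; have := B _ b hy; have := B _ c hz; have := B _ d ht.
have := ler_normD ((x - x0) * a + (y - y0) * b + (z - z0) * c) ((t - t0) * d).
have := ler_normD ((x - x0) * a + (y - y0) * b) ((z - z0) * c).
have := ler_normD ((x - x0) * a) ((y - y0) * b).
lra.
Qed.

(** The limit system reads [z0 + z1 = z0 - z1 = z2 + z3 = z2 - z3 = e]. Each row is off by at most
    [T / 40], so [T <= 2 * |e| + 4 * T / 40], which is the constant [20 / 9]. *)
Lemma tip_system_bounds (w : 'M[R]_4) (z : 'cV[R]_4) (e : R) :
  (forall i j, `|w i j - tip_matrix i j| <= 1 / 40) -> w *m z = const_mx e ->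
  let T := `|z 0 0| + `|z 1 0| + `|z 2%:R 0| + `|z 3%:R 0| in
  [/\ T <= 20 / 9 * `|e|, `|z 0 0 - e| <= T / 40, `|z 1 0| <= T / 40,
     `|z 2%:R 0 - e| <= T / 40 & `|z 3%:R 0| <= T / 40].
Proof.
move=> ww wz T.
have E i : w i 0 * z 0 0 + w i 1 * z 1 0 + w i 2%:R * z 2%:R 0 + w i 3%:R * z 3%:R 0 = e.
  have /matrixP/(_ i 0) := wz; rewrite !mxE !big_ord_recl big_ord0 addr0 !addrA => <-.
  by congr (_ * _ + _ * _ + _ * _ + _ * _); congr fun_of_matrix; exact: val_inj.
have D i := perturbed_product (z 0 0) (z 1 0) (z 2%:R 0) (z 3%:R 0)
  (ww i 0) (ww i 1) (ww i 2%:R) (ww i 3%:R).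
have := D 0; have := D 1; have := D 2%:R; have := D 3%:R; rewrite !E -/T !mxE /=.
rewrite !ler_norml => /andP[a1 a2] /andP[b1 b2] /andP[c1 c2] /andP[d1 d2].
have h0 : `|z 0 0 - e| <= T / 40 by rewrite ler_norml; apply/andP; split; lra.
have h1 : `|z 1 0| <= T / 40 by rewrite ler_norml; apply/andP; split; lra.
have h2 : `|z 2%:R 0 - e| <= T / 40 by rewrite ler_norml; apply/andP; split; lra.
have h3 : `|z 3%:R 0| <= T / 40 by rewrite ler_norml; apply/andP; split; lra.
split; rewrite -?ler_norml//.
have := ler_normD (z 0 0 - e) e; have := ler_normD (z 2%:R 0 - e) e.
rewrite !subrK /T; move: h0 h1 h2 h3; rewrite /T; lra.
Qed.

(** The bounds with [e = 0] give invertibility; with [e = 1] they give [T / 40 <= 1 / 18]. *)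
Lemma tip_system (w : 'M[R]_4) : (forall i j, `|w i j - tip_matrix i j| <= 1 / 40) ->
  exists z : 'cV[R]_4, [/\ w *m z = const_mx 1, `|z 0 0 - 1| <= 1 / 18, `|z 1 0| <= 1 / 18,
    `|z 2%:R 0 - 1| <= 1 / 18 & `|z 3%:R 0| <= 1 / 18].
Proof.
move=> ww.
have wU : w \in unitmx.
  rewrite -unitmx_tr -row_free_unit; apply: inj_row_free => v vw.
  have wz : w *m v^T = const_mx 0 by rewrite -[w]trmxK -trmx_mul vw trmx0.
  have [+ _ _ _ _] := tip_system_bounds ww wz; rewrite normr0 mulr0 => T0.
  have vi i : `|v^T i 0| <= 0.
    have := normr_ge0 (v^T 0 0); have := normr_ge0 (v^T 1 0).
    have := normr_ge0 (v^T 2%:R 0); have := normr_ge0 (v^T 3%:R 0) => n3 n2 n1 n0.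
    have H k : (k = 0 \/ k = 1 \/ k = 2%:R \/ k = 3%:R) -> `|v^T k 0| <= 0.
      by move=> [->|[->|[->|->]]]; lra.
    apply: H; case: i => -[|[|[|[|//]]]] k4.
    - by left; exact: val_inj.
    - by right; left; exact: val_inj.
    - by right; right; left; exact: val_inj.
    - by right; right; right; exact: val_inj.
  by apply/rowP => i; apply/eqP; have := vi i; rewrite !mxE normr_le0.
pose z : 'cV[R]_4 := invmx w *m const_mx 1.
have wz : w *m z = const_mx 1 by rewrite /z mulKVmx.
exists z.
have [] := tip_system_bounds ww wz; rewrite normr1 mulr1.
move: (_ + `|z 3%:R 0|) => T T1 h0 h1 h2 h3; have T18 : T / 40 <= 1 / 18 by lra.
by split => //; apply: le_trans T18.
Qed.

Variables (phi psi p q : R).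
Hypotheses (p_gt0 : 0 < p) (p_le : p <= 1 / 6) (q_gt0 : 0 < q) (q_le : q <= 1 / 6).

Lemma sin_neq0 (x : R) : 0 < x -> x <= 1 / 6 -> sin x != 0.
Proof. move=> x0 x6; have sx : x / 2 <= sin x by apply: sin_ge_half => //; lra.
by rewrite gt_eqF//; lra. Qed.

Lemma one_sub_cos_neq0 (x : R) : 0 < x -> x <= 1 / 6 -> 1 - cos x != 0.
Proof.
move=> x0 x6; rewrite versin_half mulf_neq0// expf_neq0// sin_neq0//; lra.
Qed.

(** By the addition formulas, combinations of sines and versines about any center are exactly the
    restrictions to the torus of affine functions of the ambient space. *)
Lemma trig_functional (z0 z1 z2 z3 : R) : exists (c : E4) (b : R), forall x,
  dot c (torus_point x) = b + z0 * nversin p (x.1 - phi) + z1 * nsin p (x.1 - phi)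
    + z2 * nversin q (x.2 - psi) + z3 * nsin q (x.2 - psi).
Proof.
have sp := sin_neq0 p_gt0 p_le; have sq := sin_neq0 q_gt0 q_le.
have cp := one_sub_cos_neq0 p_gt0 p_le; have cq := one_sub_cos_neq0 q_gt0 q_le.
pose a0 := - z0 / (1 - cos p); pose a1 := z1 / sin p.
pose a2 := - z2 / (1 - cos q); pose a3 := z3 / sin q.
exists (\row_(i < 4) [:: a0 * cos phi - a1 * sin phi; a0 * sin phi + a1 * cos phi;
   a2 * cos psi - a3 * sin psi; a2 * sin psi + a3 * cos psi]`_i), (a0 + a2) => x.
rewrite dot_torus_point !mxE /= /nversin /nsin !cosB !sinB /a0 /a1 /a2 /a3.
by field; rewrite sp sq cp cq.
Qed.

Variables (u : 'I_4 -> R * R).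

Definition coordinates (x : R * R) : seq R :=
  [:: nversin p (x.1 - phi); nsin p (x.1 - phi); nversin q (x.2 - psi); nsin q (x.2 - psi)].

Definition tip_values : 'M[R]_4 := \matrix_(i, j) (coordinates (u i))`_j.

Hypothesis u_tips : forall i j, `|tip_values i j - tip_matrix i j| <= 1 / 40.

(** The upper bounds exclude points that are close to the center across the cut of the circle. *)
Definition far_from_center (x : R * R) : Prop :=
  (2 * p <= `|x.1 - phi| <= 2 * pi - 2 * p) \/ (2 * q <= `|x.2 - psi| <= 2 * pi - 2 * q).

Let t i := @torus_point R (u i).

(** The functionals behind columns 1, 2, 3 of [tip_matrix] turn a vanishing combination into
    [2 * a1 + a2 + a3], [a2 + a3] and [a2 - a3] all being at most [T / 20] in absolute value, where
    [T] is the sum of the [|ai|]; hence [T <= 3 * T / 20]. *)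
Lemma tips_free : free [:: t 1 - t 0; t 2%:R - t 0; t 3%:R - t 0].
Proof.
have [c1 [b1 E1]] := trig_functional 0 1 0 0.
have [c2 [b2 E2]] := trig_functional 0 0 1 0.
have [c3 [b3 E3]] := trig_functional 0 0 0 1.
suff main a1 a2 a3 : a1 *: (t 1 - t 0) + (a2 *: (t 2%:R - t 0) + a3 *: (t 3%:R - t 0)) = 0 ->
    [/\ a1 = 0, a2 = 0 & a3 = 0].
  apply/freeP => k; rewrite !big_ord_recl big_ord0 addr0 /= => /main[k0 k1 k2].
  case=> -[|[|[|//]]] k3.
  - by rewrite -[RHS]k0; congr k; exact: val_inj.
  - by rewrite -[RHS]k1; congr k; exact: val_inj.
  - by rewrite -[RHS]k2; congr k; exact: val_inj.
move=> a0.
have D c b g : (forall x, dot c (torus_point x) = b + g x) ->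
    a1 * (g (u 1) - g (u 0)) + a2 * (g (u 2%:R) - g (u 0)) + a3 * (g (u 3%:R) - g (u 0)) = 0.
  move=> Eg; have := congr1 (dot c) a0; rewrite !dotD !dotZ !dotB !Eg.
  have -> : dot c 0 = 0 by rewrite -(scale0r 0) dotZ mul0r.
  by move=> <-; ring.
have {}E1 x : dot c1 (torus_point x) = b1 + nsin p (x.1 - phi).
  by rewrite E1 !mul0r mul1r !addr0.
have {}E2 x : dot c2 (torus_point x) = b2 + nversin q (x.2 - psi).
  by rewrite E2 !mul0r mul1r !addr0.
have {}E3 x : dot c3 (torus_point x) = b3 + nsin q (x.2 - psi).
  by rewrite E3 !mul0r mul1r !addr0.
have := D _ _ _ E1; have := D _ _ _ E2; have := D _ _ _ E3.
have val (i j : 'I_4) : `|(coordinates (u i))`_j - tip_matrix i j| <= 1 / 40.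
  by have := u_tips i j; rewrite mxE.
have diff (i j : 'I_4) : `|((coordinates (u i))`_j - (coordinates (u 0))`_j) -
    (tip_matrix i j - tip_matrix 0 j)| <= 1 / 20.
  have := val i j; have := val 0 j; rewrite !ler_norml.
  by move=> /andP[? ?] /andP[? ?]; apply/andP; split; lra.
have P (j : 'I_4) := @perturbed_product (1 / 20) a1 a2 a3 0 _ _ _ 0 _ _ _ 0
  (diff 1 j) (diff 2%:R j) (diff 3%:R j) (ltac:(rewrite subrr normr0; lra)).
have := P 1; have := P 2%:R; have := P 3%:R; rewrite !mxE /= normr0 !mulr0 !addr0.
set T := _ + `|a3| => h3 h2 h1 d3 d2 d1.
have {}h1 : `|- 2 * a1 - a2 - a3| <= 1 / 20 * T.
  by move: h1; rewrite -normrN; congr (`|_| <= _); lra.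
have {}h2 : `|a2 + a3| <= 1 / 20 * T.
  by move: h2; rewrite -normrN; congr (`|_| <= _); lra.
have {}h3 : `|a2 - a3| <= 1 / 20 * T.
  by move: h3; rewrite -normrN; congr (`|_| <= _); lra.
move: h1 h2 h3; rewrite !ler_norml => /andP[? ?] /andP[? ?] /andP[? ?].
have k1 : `|a1| <= T / 20 by rewrite ler_norml; apply/andP; split; lra.
have k2 : `|a2| <= T / 20 by rewrite ler_norml; apply/andP; split; lra.
have k3 : `|a3| <= T / 20 by rewrite ler_norml; apply/andP; split; lra.
have T0 : T <= 0 by move: k1 k2 k3; rewrite /T; lra.
by split; apply/eqP; rewrite -normr_le0; lra.
Qed.

Lemma far_nversin x : far_from_center x ->
  2 <= nversin p (x.1 - phi) + nversin q (x.2 - psi).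
Proof.
have := nversin_ge0 p (x.1 - phi); have := nversin_ge0 q (x.2 - psi) => v2 v1.
move=> [/andP[l r]|/andP[l r]].
  by have := nversin_far p_gt0 p_le l r; lra.
by have := nversin_far q_gt0 q_le l r; lra.
Qed.

Lemma tip_facet (S : set E4) (x4 : R * R) :
  S `<=` @clifford_torus R -> (forall i, S (t i)) ->
  (forall x, param_domain x -> S (torus_point x) -> (exists i, x = u i) \/ far_from_center x) ->
  S (torus_point x4) -> far_from_center x4 ->
  has_affine_dim 4 (conv_hull S) /\
  exists2 F, faces 3 (conv_hull S) F & S `&` F = [set t 0; t 1; t 2%:R; t 3%:R].
Proof.
move=> ST St Sx S4 far4.
have [z [wz z0 z1 z2 z3]] := tip_system u_tips.
have [c [b E]] := trig_functional (- z 0 0) (- z 1 0) (- z 2%:R 0) (- z 3%:R 0).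
have tight i : dot c (t i) = b - 1.
  have /matrixP/(_ i 0) := wz; rewrite /t E !mxE !big_ord_recl big_ord0 addr0 !mxE /= => <-.
  rewrite -!addrA; congr (_ + _); rewrite !opprD !mulNr ![z _ _ * _]mulrC.
  by congr (- (_ * _) + (- (_ * _) + (- (_ * _) - _ * _)));
    congr fun_of_matrix; exact: val_inj.
(* With [s = s1 + s2 >= 2], the functional lies below [b] by at least
   [17 / 18 * s - 1 / 18 * (2 + s) >= 5 / 3], more than the 1 at the tips. *)
have far x : far_from_center x -> dot c (torus_point x) < b - 1.
  move=> /far_nversin; rewrite E.
  have := nversin_ge0 p (x.1 - phi); have := nversin_ge0 q (x.2 - psi).
  have := nsin_le (x.1 - phi) p_gt0 p_le; have := nsin_le (x.2 - psi) q_gt0 q_le.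
  set s1 := nversin p _; set s2 := nversin q _; set r1 := nsin p _; set r2 := nsin q _.
  move=> r2s r1s s20 s10 s12.
  have m1 : `|z 1 0 * r1| <= 1 / 18 * (1 + s1) by rewrite normrM ler_pM.
  have m3 : `|z 3%:R 0 * r2| <= 1 / 18 * (1 + s2) by rewrite normrM ler_pM.
  move: m1 m3 z0 z2; rewrite !ler_norml => /andP[? ?] /andP[? ?] /andP[? ?] /andP[? ?].
  nra.
have Sle x : S x -> dot c x <= b - 1.
  move=> Sx'; have [y Dy yx] := ST _ Sx'; move: Sx'; rewrite -yx => Sy.
  have [[i ->]|/far/ltW//] := Sx _ Dy Sy.
  by have := tight i; rewrite /t => ->.
have tightE : S `&` [set x | dot c x = b - 1] = [set t 0; t 1; t 2%:R; t 3%:R].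
  apply/seteqP; split; last first.
    by move=> x [[[->|->]|->]|->]; split => //; exact: tight.
  move=> x [Sx' /= xb]; have [y Dy yx] := ST _ Sx'; move: Sx' xb; rewrite -yx => Sy yb.
  have [[i ->]|/far] := Sx _ Dy Sy; last by rewrite yb ltxx.
  have H k : (k = 0 \/ k = 1 \/ k = 2%:R \/ k = 3%:R) ->
      [set t 0; t 1; t 2%:R; t 3%:R] (t k).
    by move=> [->|[->|[->|->]]]; [left; left; left|left; left; right|left; right|right].
  apply: H; case: i => -[|[|[|[|//]]]] k4.
  - by left; exact: val_inj.
  - by right; left; exact: val_inj.
  - by right; right; left; exact: val_inj.
  - by right; right; right; exact: val_inj.
have [dim4 face] := tight_simplex_facet Sle tightE tips_free S4 (far _ far4).
split => //; exists (conv_hull S `&` [set x | dot c x = b - 1]) => //.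
rewrite -tightE; apply/seteqP; split => [x [Sx' [_ xb]]|x [Sx' xb]]; split => //.
by split => //; exact: sub_conv_hull.
Qed.

End TipFacets.

(** * Boxes of all aspect ratios and their six pieces *)

Section LowerBound.
Set Implicit Arguments. Unset Strict Implicit.
Context {R : realType}.
Local Notation E4 := 'rV[R]_4.

(** A box side is six half-widths. The boxes fill the unit square only, which keeps them away from
    the cut at [pi] and bounds the half-widths by [1 / 6], as the tip estimates require. *)
Definition half_width (a : nat) : R := (6 * 2 ^+ a)^-1.
Definition midpoint (a j : nat) : R := (j%:R + 1 / 2) / 2 ^+ a.

Definition strip (a j : nat) (lo hi : R) : set R :=
  `]midpoint a j + lo * half_width a, midpoint a j + hi * half_width a].

Lemma in_strip a j lo hi x : strip a j lo hi x =
  (midpoint a j + lo * half_width a < x <= midpoint a j + hi * half_width a) :> Prop.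
Proof. by rewrite /strip /= in_itv. Qed.

Definition strip_rect (q : (nat * nat) * (nat * nat)) (lo hi lo' hi' : R) : set (R * R) :=
  strip q.1.1 q.2.1 lo hi `*` strip q.1.2 q.2.2 lo' hi'.

(* Pieces 0-3 are small neighbourhoods of the four tips of an axis-parallel
   ellipse, piece 4 lies outside of the ellipse and makes the polytope
   4-dimensional, piece 5 is the rest of the box. *)
Definition piece (q : (nat * nat) * (nat * nat)) (i : nat) : set (R * R) :=
  if (i < 4)%N then
    strip_rect q ([:: 1; -1; 0; 0]`_i - 1 / 300) ([:: 1; -1; 0; 0]`_i + 1 / 300)
      ([:: 0; 0; 1; -1]`_i - 1 / 300) ([:: 0; 0; 1; -1]`_i + 1 / 300)
  else if i == 4%N then strip_rect q 2 3 2 3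
  else strip_rect q (- 3) 3 (- 3) 3 `\`
    (\bigcup_(k in [set k | (k < 4)%N])
      strip_rect q ([:: 1; -1; 0; 0]`_k - 1 / 300) ([:: 1; -1; 0; 0]`_k + 1 / 300)
        ([:: 0; 0; 1; -1]`_k - 1 / 300) ([:: 0; 0; 1; -1]`_k + 1 / 300))
    `\` strip_rect q 2 3 2 3.

Definition lower_boxes (L : nat) : seq ((nat * nat) * (nat * nat)) :=
  [seq ((a, L - a)%N, b) | a <- iota 0 L.+1, b <- cells (a, L - a)%N].

Lemma lower_boxesP L q : q \in lower_boxes L ->
  [/\ (q.1.1 + q.1.2)%N = L, (q.2.1 < 2 ^ q.1.1)%N & (q.2.2 < 2 ^ q.1.2)%N].
Proof.
move=> /allpairsPdep[a [b [aL + ->]]] /= => /allpairsPdep[j [j' [jL jL' ->]]].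
by move: aL jL jL'; rewrite !mem_iota /= => aL jL jL'; split; rewrite //; lia.
Qed.

Lemma lower_boxes_uniq L : uniq (lower_boxes L).
Proof.
apply: allpairs_uniq_dep; first exact: iota_uniq.
  by move=> a _; apply: allpairs_uniq; rewrite ?iota_uniq// => -[x y] [x' y'].
by move=> [a b] [a' b'] _ _ /= [-> _ ->].
Qed.

Lemma size_lower_boxes L : size (lower_boxes L) = (L.+1 * 2 ^ L)%N.
Proof.
rewrite size_allpairs_dep -[iota 0 L.+1]/(index_iota 0 L.+1).
rewrite sumnE big_map big_seq (eq_bigr (fun=> (2 ^ L)%N)).
  by rewrite -big_seq big_const_seq count_predT size_iota iter_addn_0 mulnC subn0.
move=> a; rewrite mem_index_iota => /andP[_ aL].
by rewrite size_allpairs !size_iota -expnD subnKC.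
Qed.

Lemma half_width_gt0 a : 0 < half_width a.
Proof. by rewrite /half_width invr_gt0 mulr_gt0// exprn_gt0. Qed.

Lemma half_width_le a : half_width a <= 1 / 6.
Proof.
rewrite /half_width invfM mul1r ler_piMr ?invr_ge0// invf_le1 ?exprn_gt0//.
by rewrite exprn_ege1// ler1n.
Qed.

Lemma half_widthM a b : half_width a * half_width b = 1 / 36 * (2 ^+ (a + b))^-1.
Proof. by rewrite /half_width exprD; field; rewrite !expf_neq0. Qed.

Lemma strip_bounds a j : (j < 2 ^ a)%N ->
  0 <= midpoint a j - 3 * half_width a /\ midpoint a j + 3 * half_width a <= 1.
Proof.
move=> ja; have a0 : 0 < 2 ^+ a :> R by rewrite exprn_gt0.
have -> : midpoint a j - 3 * half_width a = j%:R / 2 ^+ a.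
  by rewrite /midpoint /half_width; field; exact: lt0r_neq0.
have -> : midpoint a j + 3 * half_width a = (j%:R + 1) / 2 ^+ a.
  by rewrite /midpoint /half_width; field; exact: lt0r_neq0.
by rewrite divr_ge0 ?(ltW a0)// ler_pdivrMr// mul1r natr1 -natrX ler_nat.
Qed.

(** A tip piece has sides of [2 / 300] half-widths, that is [1 / 900] of the sides of the box. *)
Definition tip_area : R := 1 / 900 / 900.

Lemma tip_area_gt0 : 0 < tip_area.
Proof. by rewrite /tip_area; lra. Qed.

Lemma tip_area_le1 : tip_area <= 1.
Proof. by rewrite /tip_area; lra. Qed.

Section Box.
Variable q : (nat * nat) * (nat * nat).
Hypotheses (q1 : (q.2.1 < 2 ^ q.1.1)%N) (q2 : (q.2.2 < 2 ^ q.1.2)%N).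

Lemma strip_rect_chart lo hi lo' hi' : - 3 <= lo -> hi <= 3 -> - 3 <= lo' -> hi' <= 3 ->
  chart (strip_rect q lo hi lo' hi').
Proof.
move=> l1 h1 l2 h2; have [a b] := strip_bounds q1; have [a' b'] := strip_bounds q2.
have pi2 := pi_ge2 R; have p0 := half_width_gt0 q.1.1; have p0' := half_width_gt0 q.1.2.
by apply: rect_chart; nra.
Qed.

Lemma area_strip_rect lo hi lo' hi' : - 3 <= lo -> lo <= hi -> hi <= 3 ->
  - 3 <= lo' -> lo' <= hi' -> hi' <= 3 ->
  area (strip_rect q lo hi lo' hi') =
  (hi - lo) * (hi' - lo') / 36 * (2 ^+ (q.1.1 + q.1.2))^-1.
Proof.
move=> l1 lh1 h1 l2 lh2 h2; have [a b] := strip_bounds q1; have [a' b'] := strip_bounds q2.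
have pi2 := pi_ge2 R; have p0 := half_width_gt0 q.1.1; have p0' := half_width_gt0 q.1.2.
rewrite area_rect; [|nra|nra|nra|nra|nra|nra].
transitivity ((hi - lo) * (hi' - lo') * (half_width q.1.1 * half_width q.1.2)); first by ring.
by rewrite half_widthM; ring.
Qed.

Lemma piece_chart i : chart (piece q i).
Proof.
have H k : chart (strip_rect q ([:: 1; -1; 0; 0]`_k - 1 / 300) ([:: 1; -1; 0; 0]`_k + 1 / 300)
        ([:: 0; 0; 1; -1]`_k - 1 / 300) ([:: 0; 0; 1; -1]`_k + 1 / 300)).
  by case: k => [|[|[|[|k]]]] /=; rewrite ?nth_nil; apply: strip_rect_chart; lra.
rewrite /piece; case: ifP => // _; case: ifP => _; first by apply: strip_rect_chart; lra.
apply: chartD; last by apply: strip_rect_chart; lra.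
apply: chartD; first by apply: strip_rect_chart; lra.
by apply: chart_bigcup.
Qed.

Lemma area_piece i : (i < 5)%N ->
  tip_area / 2 ^+ (q.1.1 + q.1.2) <= area (piece q i) /\
  area (piece q i) <= 1 / 2 ^+ (q.1.1 + q.1.2).
Proof.
have a0 : 0 < (2 ^+ (q.1.1 + q.1.2))^-1 :> R by rewrite invr_gt0 exprn_gt0.
case: i => [|[|[|[|[|//]]]]] _; rewrite /tip_area /piece /= area_strip_rect; try lra; split; lra.
Qed.

Lemma piece_subset_box i : piece q i `<=` strip_rect q (- 3) 3 (- 3) 3.
Proof.
have p0 := half_width_gt0 q.1.1; have p0' := half_width_gt0 q.1.2.
have S lo hi lo' hi' : - 3 <= lo -> hi <= 3 -> - 3 <= lo' -> hi' <= 3 ->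
    strip_rect q lo hi lo' hi' `<=` strip_rect q (- 3) 3 (- 3) 3.
  move=> l1 h1 l2 h2 [x y] [/=]; rewrite !in_strip => /andP[? ?] /andP[? ?].
  by split; rewrite /= in_strip; apply/andP; split; nra.
rewrite /piece; case: ifP => [|_].
  by case: i => [|[|[|[|//]]]] _ /=; apply: S; lra.
by case: ifP => _; [apply: S; lra|move=> x [[]]].
Qed.

Lemma area_rest : area (piece q 5) <= 1 / 2 ^+ (q.1.1 + q.1.2).
Proof.
apply: le_trans (area_le (piece_chart 5) _ (@piece_subset_box 5)) _.
  by apply: strip_rect_chart; lra.
rewrite area_strip_rect; lra.
Qed.

Lemma box_cover x : strip_rect q (- 3) 3 (- 3) 3 x -> exists2 i, (i < 6)%N & piece q i x.
Proof.
move=> xb; have [x5|x5] := pselect (piece q 5 x); first by exists 5%N.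
have [x4|x4] := pselect (piece q 4 x); first by exists 4%N.
have [[k k4 xk]|xk] := pselect ((\bigcup_(k in [set k | (k < 4)%N]) piece q k) x).
  by exists k => //; apply: (leq_trans k4).
exfalso; apply: x5; rewrite /piece /=; split => //; split => // -[k /= k4 xk'].
by apply: xk; exists k => //; rewrite /piece k4.
Qed.

Lemma piece_trivIset : trivIset setT (fun i : 'I_6 => piece q i).
Proof.
have p0 := half_width_gt0 q.1.1; have p0' := half_width_gt0 q.1.2.
have D5 i : (i < 5)%N -> piece q i `&` piece q 5 = set0.
  move=> i5; apply/seteqP; split => // x [xi [[_ xn] x4]]; move: xi; rewrite /piece.
  case: ifP => [i4|i4]; first by move=> xi; apply: xn; exists i.
  by case: ifP => //; move: i5 i4; clear; lia.
have D i j : (i < j)%N -> (j < 5)%N -> piece q i `&` piece q j = set0.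
  move=> ij j5; apply/seteqP; split => // -[x y] [].
  case: j ij j5 => [|[|[|[|[|//]]]]] // + _; case: i => [|[|[|[|//]]]] // _;
    rewrite /piece /= /strip_rect => -[/=]; rewrite !in_strip => /andP[? ?] /andP[? ?] [];
    move=> /andP[? ?] /andP[? ?]; lra.
apply/trivIsetP => i j _ _ ij.
have [i5|i5] := ltnP i 5; have [j5|j5] := ltnP j 5.
- case: (ltngtP i j) => [ij'|ji|/val_inj ij']; [exact: D|rewrite setIC; exact: D|].
  by rewrite ij' eqxx in ij.
- have -> : j = 5%N :> nat by apply/eqP; rewrite eqn_leq j5 andbT -ltnS ltn_ord.
  exact: D5.
- have -> : i = 5%N :> nat by apply/eqP; rewrite eqn_leq i5 andbT -ltnS ltn_ord.
  by rewrite setIC; exact: D5.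
- exfalso; move/eqP: ij; apply; apply/val_inj/eqP => /=.
  by have := ltn_ord i; have := ltn_ord j; move: i5 j5; clear; lia.
Qed.

(** The tolerance [1 / 300] originates here: [nversin_near1] loses a factor 7, and
    [7 / 300 <= 1 / 40]. *)
Lemma strip_tip a j (s x : R) : s = 1 \/ s = -1 \/ s = 0 ->
  strip a j (s - 1 / 300) (s + 1 / 300) x ->
  `|nversin (half_width a) (x - midpoint a j) - s ^+ 2| <= 1 / 40 /\
  `|nsin (half_width a) (x - midpoint a j) - s| <= 1 / 40.
Proof.
have p0 := half_width_gt0 a; have p6 := half_width_le a.
move=> s3; rewrite in_strip => /andP[xl xr].
have xs : `|x - midpoint a j - s * half_width a| <= 1 / 300 * half_width a.
  by rewrite ler_norml; apply/andP; split; lra.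
have near1 y : `|y - half_width a| <= 1 / 300 * half_width a ->
    `|nversin (half_width a) y - 1| <= 1 / 40 /\ `|nsin (half_width a) y - 1| <= 1 / 40.
  move=> ys; split.
    by apply: le_trans (nversin_near1 p0 p6 _ _ ys) _; lra.
  by apply: le_trans (nsin_near1 p0 p6 _ _ ys) _; lra.
case: s3 xs => [->|[->|->]].
- by rewrite mul1r expr1n => /near1.
- rewrite mulN1r sqrrN expr1n -normrN opprB opprK => H.
  have /near1[] : `|- (x - midpoint a j) - half_width a| <= 1 / 300 * half_width a.
    by apply: le_trans H; rewrite le_eqVlt; apply/orP; left; apply/eqP; congr Num.norm; ring.
  rewrite nversinN nsinN => -> H2; split => //.
  by apply: le_trans H2; rewrite -normrN le_eqVlt; apply/orP; left; apply/eqP; congr Num.norm; ring.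
- rewrite mul0r subr0 expr0n /= !subr0 => H; split.
    by apply: le_trans (nversin_near0 p0 p6 _ _ H) _; lra.
  by apply: le_trans (nsin_near0 p0 p6 _ H) _; lra.
Qed.

Lemma tip_values_piece (u : 'I_4 -> R * R) : (forall i : 'I_4, piece q i (u i)) ->
  forall i j : 'I_4, `|tip_values (midpoint q.1.1 q.2.1) (midpoint q.1.2 q.2.2)
    (half_width q.1.1) (half_width q.1.2) u i j - tip_matrix i j| <= 1 / 40.
Proof.
move=> uP i j; have := uP i; rewrite /piece ltn_ord => -[/=].
have tipP (r : seq R) : r = [:: 1; -1; 0; 0] \/ r = [:: 0; 0; 1; -1] ->
    r`_i = 1 \/ r`_i = -1 \/ r`_i = 0.
  by move=> rE; case: i => -[|[|[|[|//]]]] ? /=; case: rE => ->; tauto.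
have s1 := tipP _ (or_introl erefl); have s2 := tipP _ (or_intror erefl).
move=> /(strip_tip s1)[a1 a2] /(strip_tip s2)[b1 b2].
rewrite !mxE /coordinates.
move: a1 a2 b1 b2; clear s1 s2 tipP; case: i => -[|[|[|[|//]]]] i4;
  case: j => -[|[|[|[|//]]]] j4 /=; by rewrite ?expr0n ?sqrrN ?expr1n /= => a1 a2 b1 b2.
Qed.

Lemma far_of_piece4 x : piece q 4 x ->
  far_from_center (midpoint q.1.1 q.2.1) (midpoint q.1.2 q.2.2)
    (half_width q.1.1) (half_width q.1.2) x.
Proof.
have p0 := half_width_gt0 q.1.1; have p6 := half_width_le q.1.1; have pi2 := pi_ge2 R.
rewrite /piece /= => -[/=]; rewrite !in_strip => /andP[a b] _.
by left; rewrite ger0_norm; [apply/andP; split|]; lra.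
Qed.

(** Some angle is at least three half-widths from the center; as the center lies in the unit square,
    the point cannot be close to it across the cut. *)
Lemma far_outside_box x : param_domain x -> ~ strip_rect q (- 3) 3 (- 3) 3 x ->
  far_from_center (midpoint q.1.1 q.2.1) (midpoint q.1.2 q.2.2)
    (half_width q.1.1) (half_width q.1.2) x.
Proof.
have pi2 := pi_ge2 R => -[/=]; rewrite !in_itv/= => /andP[x1 x2] /andP[y1 y2] xb.
have H a j z : (j < 2 ^ a)%N -> - pi < z -> z <= pi -> ~ strip a j (- 3) 3 z ->
    2 * half_width a <= `|z - midpoint a j| <= 2 * pi - 2 * half_width a.
  move=> /strip_bounds[b1 b2] z1 z2; rewrite in_strip => /negP; rewrite negb_and -leNgt -ltNge.
  have p0 := half_width_gt0 a; have p6 := half_width_le a.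
  move=> /orP[zl|zr].
    by rewrite ler0_norm; [apply/andP; split|]; lra.
  by rewrite ger0_norm; [apply/andP; split|]; lra.
have [s1|s1] := pselect (strip q.1.1 q.2.1 (- 3) 3 x.1); last by left; exact: H.
have [s2|s2] := pselect (strip q.1.2 q.2.2 (- 3) 3 x.2); last by right; exact: H.
by exfalso; apply: xb.
Qed.

End Box.
End LowerBound.

(** * Distinct boxes give distinct facets; probability of the tip configuration *)

Section LowerExpectation.
Set Implicit Arguments. Unset Strict Implicit.
Context {R : realType}.
Local Notation E4 := 'rV[R]_4.

Lemma finite_facets (S : set E4) : finite_set S -> has_affine_dim 4 (conv_hull S) ->
  finite_set (faces 3 (conv_hull S)).
Proof.
move=> finS dim4.
apply: (@sub_finite_set _ _ (flat_section (conv_hull S) @` (S `*` S `*` S `*` S))).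
  move=> F /(facet_flat_section finS dim4)[c [b [_ _ [p0 [p1 [p2 [p3 /= [T0 T1 T2 T3 ->]]]]]]]].
  by exists (p0, p1, p2, p3) => //; case: T0; case: T1; case: T2; case: T3.
by apply: finite_image; do 3 (apply: finite_setX => //).
Qed.

Definition tip_set (S : set E4) (q : (nat * nat) * (nat * nat)) (F : set E4) : Prop :=
  exists u : 'I_4 -> R * R, (forall i : 'I_4, piece q i (u i)) /\
    S `&` F = [set torus_point (u 0); torus_point (u 1);
                   torus_point (u 2%:R); torus_point (u 3%:R)].

(** For equal shapes, a common tip puts the midpoints less than six half-widths apart, which is the
    spacing of the boxes. For different shapes, two opposite tips of the longer box are almost two
    of its half-widths apart, too far for the tips of a box at most half as long. *)
Lemma tip_set_inj L S q q' F : q \in lower_boxes L -> q' \in lower_boxes L ->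
  tip_set S q F -> tip_set S q' F -> q = q'.
Proof.
move=> /lower_boxesP[qL j1 j2] /lower_boxesP[qL' j1' j2'].
wlog aa : q q' qL qL' j1 j2 j1' j2' / (q.1.1 <= q'.1.1)%N.
  by move=> H t t'; have [aa|/ltnW aa] := leqP q.1.1 q'.1.1; [exact: H|apply/esym; exact: H].
move=> [u [uP uE]] [v [vP vE]].
have uv i : (i = 0 \/ i = 1 \/ i = 2%:R \/ i = 3%:R) -> exists k : 'I_4, u i = v k.
  move=> i4; have : [set torus_point (v 0); torus_point (v 1); torus_point (v 2%:R);
      torus_point (v 3%:R)] (torus_point (u i)).
    rewrite -vE uE; move: i4 => [->|[->|[->|->]]];
      by [left; left; left|left; left; right|left; right|right].
  have Du : param_domain (u i) by have [D _ _] := piece_chart (R := R) j1 j2 i; exact: (D _ (uP i)).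
  have Dv k : param_domain (v k).
    by have [D _ _] := piece_chart (R := R) j1' j2' k; exact: (D _ (vP k)).
  by move=> [[[|]|]|] /= /torus_point_inj H; [exists 0|exists 1|exists 2%:R|exists 3%:R]; apply: H.
have near k : `|(v k).1 - midpoint q'.1.1 q'.2.1| <= (1 + 1 / 300) * half_width q'.1.1 /\
    `|(v k).2 - midpoint q'.1.2 q'.2.2| <= (1 + 1 / 300) * half_width q'.1.2.
  have p0 := half_width_gt0 (R := R) q'.1.1; have p0' := half_width_gt0 (R := R) q'.1.2.
  have := vP k; rewrite /piece ltn_ord => -[/=]; rewrite !in_strip.
  by case: k => -[|[|[|[|//]]]] k4 /= /andP[? ?] /andP[? ?]; rewrite !ler_norml;
    split; apply/andP; split; lra.
have [aE|aN] := eqVneq q.1.1 q'.1.1.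
  have bE : q.1.2 = q'.1.2 by move: qL qL' aE; clear; lia.
  have [k u0] := uv 0 (or_introl erefl).
  have := uP 0; rewrite u0 /piece /= => -[/=]; rewrite !in_strip aE bE => /andP[a1 a2] /andP[b1 b2].
  have [] := near k; rewrite !ler_norml => /andP[c1 c2] /andP[d1 d2].
  have same a j j' : `|midpoint a j - midpoint a j'| < 6 * half_width a :> R -> j = j'.
    have e0 : 0 < 2 ^+ a :> R by rewrite exprn_gt0.
    have -> : midpoint a j - midpoint a j' = (j%:R - j'%:R) / 2 ^+ a :> R.
      by rewrite /midpoint -mulrBl; congr (_ / _); ring.
    have -> : 6 * half_width a = (2 ^+ a)^-1 :> R by rewrite /half_width invfM mulVKf.
    rewrite normrM normfV (gtr0_norm e0) ltr_pdivrMr// mulVf ?gt_eqF// ltr_norml.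
    move=> /andP[]; rewrite ltrBrDl ltrBlDr => h1 h2; apply/eqP; rewrite eqn_leq.
    by apply/andP; split; rewrite -ltnS -(ltr_nat R) -natr1; lra.
  have p0 := half_width_gt0 (R := R) q'.1.1; have p0' := half_width_gt0 (R := R) q'.1.2.
  have jE : q.2.1 = q'.2.1 by apply: (same q'.1.1); rewrite ltr_norml; apply/andP; split; lra.
  have jE' : q.2.2 = q'.2.2 by apply: (same q'.1.2); rewrite ltr_norml; apply/andP; split; lra.
  case: q q' aE bE jE jE' {qL qL' j1 j2 j1' j2' aa uP uE vP vE uv
    near a1 a2 b1 b2 c1 c2 d1 d2 p0 p0'} =>
    -[a b] [j j'] [[a' b'] [k' k'']] /=.
  by move=> -> -> -> ->.
have {aN}aa : (q.1.1 < q'.1.1)%N by rewrite ltn_neqAle aN.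
exfalso; have hw : half_width q'.1.1 <= half_width q.1.1 / 2 :> R.
  rewrite /half_width -invfM lef_pV2 ?posrE ?mulr_gt0 ?exprn_gt0//.
  rewrite -mulrA -exprSr ler_pM2l//; apply: ler_weXn2l => //; lra.
have [k u0] := uv 0 (or_introl erefl).
have [l u1] := uv 1 (or_intror (or_introl erefl)).
have := uP 0; have := uP 1; rewrite u0 u1 /piece /= => -[/= + _] [/= + _]; rewrite !in_strip.
move=> /andP[a1 a2] /andP[b1 b2].
have [+ _] := near k; have [+ _] := near l; rewrite !ler_norml => /andP[c1 c2] /andP[d1 d2].
have := half_width_gt0 (R := R) q.1.1.
by move: hw a1 a2 b1 b2 c1 c2 d1 d2; clear; lra.
Qed.

Section Process.
Context {d : measure_display} {Omega : measurableType d}.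
Variables (P : probability Omega R) (rate : R) (X : Omega -> set E4).
Hypothesis rate_gt0 : 0 < rate.
Hypothesis PX : poisson_process P rate X.

(** The boolean is read as a number: one point in each of pieces 0 to 4, none in piece 5. *)
Definition tip_event (q : (nat * nat) * (nat * nat)) : set Omega :=
  \bigcap_(i in [set: 'I_6]) [set w | count X (piece q i) w = (i < 5)%N].

Lemma count_eq1 C w : C `<=` @param_domain R -> count X C w = 1%N ->
  exists u, [/\ C u, X w (torus_point u) &
    forall v, C v -> X w (torus_point v) -> v = u].
Proof.
move=> CD /eqP; rewrite /count /num_points.
have [fX _] : finite_set (X w) /\ X w `<=` @clifford_torus R by case: PX => /(_ w).
have fXC : finite_set (X w `&` @torus_point R @` C) by apply: sub_finite_set fX => x [].
move=> /cardfs1P[x xE].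
have mem y : (X w `&` @torus_point R @` C) y <-> y = x.
  split => [yC|->].
    have : y \in fset_set (X w `&` @torus_point R @` C) by rewrite in_fset_set//; exact: mem_set.
    by rewrite xE => /fset1P.
  have : x \in fset_set (X w `&` @torus_point R @` C) by rewrite xE; exact/fset1P.
  by rewrite in_fset_set// => /set_mem.
have [Xx [u Cu ux]] := (mem x).2 erefl.
exists u; split => //; first by rewrite ux.
move=> v Cv Xv; apply: torus_point_inj; [exact: CD|exact: CD|].
by rewrite ux; apply/mem; split => //; exists v.
Qed.

(** As piece 5 is empty, every point of the process is a tip, the point in piece 4, or outside the
    box; the latter two kinds are far from the center. *)
Lemma tip_event_facet q w : (q.2.1 < 2 ^ q.1.1)%N -> (q.2.2 < 2 ^ q.1.2)%N -> tip_event q w ->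
  has_affine_dim 4 (conv_hull (X w)) /\
  exists2 F, faces 3 (conv_hull (X w)) F & tip_set (X w) q F.
Proof.
move=> q1 q2 ev.
have [fX XT] : finite_set (X w) /\ X w `<=` @clifford_torus R by case: PX => /(_ w).
have one (i : nat) : (i < 5)%N -> exists u, [/\ piece q i u, X w (torus_point u) &
    forall v, piece q i v -> X w (torus_point v) -> v = u].
  move=> i5; have [D _ _] := piece_chart (R := R) q1 q2 i.
  apply: (count_eq1 D); have := ev (@Ordinal 6 i (leqW i5)) I.
  by rewrite /= i5.
have none x : piece q 5 x -> ~ X w (torus_point x).
  move=> x5 Xx; have := ev (@Ordinal 6 5 isT) I => /= /(count_eq0 PX)/seteqP[H _].
  by apply: (H (torus_point x)); split => //; exists x.
have /choice[u uP] : forall i : 'I_4, exists u, [/\ piece q i u, X w (torus_point u) &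
    forall v, piece q i v -> X w (torus_point v) -> v = u].
  by move=> i; apply: one; exact: (leqW (ltn_ord i)).
have [x4 [P4 X4 U4]] := one 4%N isT.
have tips := tip_values_piece (fun i => let: And3 h _ _ := uP i in h).
have St i : X w (torus_point (u i)) by have [] := uP i.
have Sx x : param_domain x -> X w (torus_point x) -> (exists i, x = u i) \/
    far_from_center (midpoint q.1.1 q.2.1) (midpoint q.1.2 q.2.2)
      (half_width q.1.1) (half_width q.1.2) x.
  move=> Dx Xx; have [xb|xb] := pselect (strip_rect q (- 3) 3 (- 3) 3 x); last first.
    by right; exact: far_outside_box.
  have [i i6 xi] := box_cover xb.
  have [i4|i4] := ltnP i 4.
    by left; exists (Ordinal i4); have [_ _] := uP (Ordinal i4); apply.
  move: i4; rewrite leq_eqVlt => /orP[/eqP i4|i5].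
    by right; apply: far_of_piece4; rewrite i4.
  exfalso; apply: none Xx; have -> // : 5%N = i.
  by apply/eqP; rewrite eqn_leq i5 -ltnS.
have [dim4 [F faceF FE]] := tip_facet (half_width_gt0 _) (half_width_le _)
  (half_width_gt0 _) (half_width_le _) tips XT St Sx X4 (far_of_piece4 P4).
by split => //; exists F => //; exists u; split => // i; have [] := uP i.
Qed.

(** A facet is chosen for each box where the event occurs; by [tip_set_inj] the choice is
    injective. *)
Lemma number_of_tip_events_le L w :
  (\sum_(q <- lower_boxes L) (w \in tip_event q) <= f3 (conv_hull (X w)))%N.
Proof.
have [fX XT] : finite_set (X w) /\ X w `<=` @clifford_torus R by case: PX => /(_ w).
pose good := [seq q <- lower_boxes L | w \in tip_event q].
have -> : (\sum_(q <- lower_boxes L) (w \in tip_event q) = size good)%N.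
  by rewrite size_filter -sum1_count [in RHS]big_mkcond; apply: eq_bigr => q _; case: (_ \in _).
have goodP q : q \in good -> has_affine_dim 4 (conv_hull (X w)) /\
    exists2 F, faces 3 (conv_hull (X w)) F & tip_set (X w) q F.
  rewrite mem_filter => /andP[/set_mem wq /lower_boxesP[_ q1 q2]].
  exact: tip_event_facet.
case: (posnP (size good)) => [->//|good0].
have dim4 : has_affine_dim 4 (conv_hull (X w)).
  by have [] := goodP _ (mem_nth ((0, 0), (0, 0))%N good0).
have fF := finite_facets fX dim4.
rewrite /f3 ifT; last exact/asboolP.
have /choice[Phi PhiP] : forall q, exists F, q \in good ->
    faces 3 (conv_hull (X w)) F /\ tip_set (X w) q F.
  move=> q; case: (boolP (q \in good)) => [/goodP[_ [F FF tF]]|_]; first by exists F.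
  by exists set0.
rewrite -(size_map Phi); apply: uniq_leq_size.
  rewrite map_inj_in_uniq ?filter_uniq ?lower_boxes_uniq//.
  move=> q q' gq gq' E; have [_ t1] := PhiP _ gq; have [_ t2] := PhiP _ gq'.
  move: gq gq'; rewrite !mem_filter => /andP[_ qL] /andP[_ qL'].
  by apply: (tip_set_inj qL qL' t1); rewrite E.
move=> F /mapP[q gq ->]; rewrite in_fset_set//; apply/mem_set.
by have [] := PhiP _ gq.
Qed.

Lemma measurable_tip_event q : (q.2.1 < 2 ^ q.1.1)%N -> (q.2.2 < 2 ^ q.1.2)%N ->
  measurable (tip_event q).
Proof.
move=> q1 q2; apply: fin_bigcap_measurable; first exact: finite_finset.
by move=> i _; exact: (measurable_count_eq PX _ (piece_chart q1 q2 i)).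
Qed.

(** The six counts are independent with means [m <= 2], and [m >= tip_area] for the first five. So
    [m * exp (- m)] and, for the last piece, [exp (- m)] are all at least [tip_area * exp (- 2)]. *)
Lemma prob_tip_event L q : 2 ^+ L <= rate -> rate < 2 ^+ L.+1 -> q \in lower_boxes L ->
  (((tip_area * expR (- 2)) ^+ 6)%:E <= P (tip_event q))%E.
Proof.
move=> rL rL1 /lower_boxesP[qL q1 q2].
have r2 : 1 <= rate / 2 ^+ L < 2.
  by rewrite ler_pdivlMr ?exprn_gt0// mul1r rL ltr_pdivrMr ?exprn_gt0// -exprS.
rewrite /tip_event (prob_counts PX (C := fun i : 'I_6 => piece q i)
  (fun i : 'I_6 => nat_of_bool (i < 5)%N)
  (fun i => piece_chart q1 q2 i) (@piece_trivIset R q)).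
have t0 : 0 < tip_area :> R := tip_area_gt0.
have c0 : 0 <= tip_area * expR (- 2) :> R by rewrite mulr_ge0 ?expR_ge0// ltW.
under eq_bigr => i _ do rewrite (prob_count rate_gt0 PX _ (piece_chart q1 q2 i)).
rewrite prodEFin lee_fin.
have -> : (tip_area * expR (- 2)) ^+ 6 = \prod_(i < 6) (tip_area * expR (- 2)) :> R.
  by rewrite prodr_const card_ord.
apply: ler_prod => i _; rewrite c0 /=.
set m := rate * area _.
have m2 : m <= 2.
  apply: (@le_trans _ _ (rate * (1 / 2 ^+ L))); last by lra.
  rewrite ler_wpM2l ?(ltW rate_gt0)// -qL.
  have [i5|i5] := ltnP i 5; first by have [] := area_piece (R := R) q1 q2 i5.
  have -> : i = 5%N :> nat by apply/eqP; rewrite eqn_leq i5 andbT -ltnS ltn_ord.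
  exact: area_rest.
have e2 : expR (- 2) <= expR (- m) by rewrite ler_expR lerN2.
have [i5|i5] := ltnP i 5; last first.
  rewrite expr0 fact0 divr1 mul1r; apply: le_trans e2.
  by rewrite ger_pMl ?expR_gt0// tip_area_le1.
rewrite expr1 factS fact0 muln1 divr1; apply: ler_pM; rewrite ?expR_ge0 ?(ltW t0)//.
apply: (@le_trans _ _ (rate * (tip_area / 2 ^+ L))).
  by rewrite mulrCA ler_peMr ?(ltW t0)//; case/andP: r2.
rewrite ler_wpM2l ?(ltW rate_gt0)// -qL.
by have [] := area_piece (R := R) q1 q2 i5.
Qed.

Lemma expected_facets_lower L : 2 ^+ L <= rate -> rate < 2 ^+ L.+1 ->
  (((tip_area * expR (- 2)) ^+ 6 * (L.+1%:R * 2 ^+ L))%:E <=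
   'E_P[fun w => (f3 (conv_hull (X w)))%:R])%E.
Proof.
move=> rL rL1; set c := _ ^+ 6; rewrite unlock.
apply: (@le_trans _ _ (\int[P]_w (\sum_(q <- lower_boxes L | q \in lower_boxes L)
    (\1_(tip_event q) w)%:E))%E); last first.
  apply: le_integral_nonmeasurable => w.
    by apply: sume_ge0 => q _; rewrite lee_fin.
  rewrite -big_seq sumEFin lee_fin -natr_sum ler_nat.
  exact: number_of_tip_events_le.
pose f q (w : Omega) : \bar R := if q \in lower_boxes L then (\1_(tip_event q) w)%:E else 0%E.
have mf q : measurable_fun setT (f q).
  rewrite /f; case: (boolP (q \in lower_boxes L)) => qL; last exact: measurable_cst.
  have [_ q1 q2] := lower_boxesP qL.
  by apply/measurable_EFinP; apply: measurable_indic; exact: measurable_tip_event.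
have f0 q w : setT w -> (0 <= f q w)%E by rewrite /f; case: ifP => _ _; rewrite ?lee_fin.
rewrite (eq_integral (fun w => (\sum_(q <- lower_boxes L) f q w)%E)); last first.
  by move=> w _; rewrite big_mkcond.
rewrite (ge0_integral_sum P measurableT mf f0).
apply: (@le_trans _ _ (\sum_(q <- lower_boxes L) c%:E)%E).
  by rewrite sumEFin big_const_seq count_predT iter_addr_0 size_lower_boxes lee_fin
    -[X in _ <= X]mulr_natr natrM natrX.
rewrite big_seq [leRHS]big_seq; apply: lee_sum => q qL; rewrite /f qL.
have [_ q1 q2] := lower_boxesP qL.
rewrite integral_indic//; last exact: measurable_tip_event.
by rewrite setIT; exact: (prob_tip_event rL rL1 qL).
Qed.

End Process.
End LowerExpectation.

(** * From dyadic rates to the asymptotic comparison *)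

Lemma dyadic_bracket (R : realType) (x : R) : 1 <= x ->
  exists L, 2 ^+ L <= x /\ x < 2 ^+ L.+1.
Proof.
move=> x1; have x0 : 0 <= x by lra.
have /andP[nx xn] := truncn_itv x0; set n := Num.truncn x in nx xn.
have n0 : (0 < n)%N by rewrite truncn_gt_nat.
exists (trunc_log 2 n); split.
  by apply: le_trans nx; rewrite -natrX ler_nat trunc_logP.
by apply: (lt_le_trans xn); rewrite -natrX ler_nat trunc_log_ltn.
Qed.

(** The upper limit is at most the supremum over [l > T], hence at most the larger of [C] and
    [1 / c]. The two bounds also make [F l] finite and positive, so the extended quotients are real
    ones. *)
Lemma Ostar_of_bounds (R : realType) (F : R -> \bar R) (G : R -> R) (c C T : R) :
  0 < c -> (forall l, T < l -> 0 < G l) ->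
  (forall l, T < l -> ((c * G l)%:E <= F l)%E) ->
  (forall l, T < l -> (F l <= (C * G l)%:E)%E) ->
  Ostar F (fun l => (G l)%:E).
Proof.
move=> c0 G0 lo up; rewrite /Ostar limf_esupE.
apply: (@le_lt_trans _ _ (Num.max C c^-1)%:E); last exact: ltry.
apply: (@le_trans _ _ (ereal_sup ((fun l =>
  maxe `|F l / (G l)%:E| `|(G l)%:E / F l|)%E @` [set l | T < l]))).
  by apply: ereal_inf_lbound; exists [set l | T < l] => //; apply: nbhs_pinfty_gt; exact: num_real.
apply: ge_ereal_sup => _ [l /= Tl <-].
have Gl := G0 _ Tl; have := lo _ Tl; have := up _ Tl.
case: (F l) => [r| |]; [|by []|by move=> _].
rewrite !lee_fin => rC cr; have r0 : 0 < r by apply: lt_le_trans cr; rewrite mulr_gt0.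
rewrite !inver !gt_eqF// -!EFinM !abse_EFin -EFin_max lee_fin.
rewrite !gtr0_norm ?divr_gt0// ge_max !le_max; apply/andP; split; apply/orP; [left|right].
  by rewrite ler_pdivrMr.
by rewrite ler_pdivrMr// mulrC ler_pdivlMr// mulrC.
Qed.

Theorem theorem2p1 (R : realType)
    (d : R -> measure_display)
    (Omega : forall lambda : R, measurableType (d lambda))
    (P : forall lambda : R, probability (Omega lambda) R)
    (X : forall lambda : R, Omega lambda -> set 'rV[R]_4)
    (HX : forall lambda : R, 0 < lambda ->
      poisson_process (P lambda) lambda (X lambda)) :
  Ostar
    (fun lambda : R => 'E_(P lambda)[fun w => (f3 (conv_hull (X lambda w)))%:R])%E
    (fun lambda : R => (lambda * ln lambda)%:E).
Proof.
have [C C0 upper] := @expected_facets_upper R.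
set c : R := (tip_area * expR (- 2)) ^+ 6.
have c0 : 0 < c.
  by apply: exprn_gt0; apply: mulr_gt0; [exact: tip_area_gt0|exact: expR_gt0].
set k : R := ln 2; have k0 : 0 < k by apply: ln_gt0; lra.
have ln2 L : ln (2 ^+ L) = k * L%:R :> R by rewrite lnXn// -[LHS]mulr_natr.
(* The last estimate adds [k * L <= ln l] and [k <= ln l]; the second uses [l > 2]. *)
have bracket (l : R) : 2 < l -> exists L, [/\ 2 ^+ L <= l, l < 2 ^+ L.+1,
    ln l <= k * L.+1%:R & k * L.+1%:R <= 2 * ln l].
  move=> l2; have [|L [Ll lL]] := @dyadic_bracket R l; first by lra.
  have l0 : 0 < l by lra.
  have p0 n : 0 < 2 ^+ n :> R by rewrite exprn_gt0.
  have h1 : ln l <= k * L.+1%:R by rewrite -ln2 ler_ln ?posrE// ltW.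
  have h2 : k * L%:R <= ln l by rewrite -ln2 ler_ln ?posrE.
  have h3 : k <= ln l by rewrite ler_ln ?posrE// ltW.
  by exists L; split => //; rewrite -natr1; lra.
(* Below, a factor 2 is lost in [l < 2 * 2 ^ L]. Above, [2 * C] comes from
   [k * (L + 1) <= 2 * ln l], and the extra 1 absorbs the additive constant 2 through
   [2 * k <= l * ln l]. *)
apply: (@Ostar_of_bounds R _ (fun l => l * ln l) (c / (2 * k)) ((1 + 2 * C) / k) 2).
- by rewrite divr_gt0// mulr_gt0.
- by move=> l l2; rewrite mulr_gt0 ?ln_gt0//; lra.
- move=> l l2; have [L [Ll lL hln _]] := bracket l l2; have l0 : 0 < l by lra.
  apply: (le_trans _ (expected_facets_lower l0 (HX l l0) Ll lL)); rewrite lee_fin -/c.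
  rewrite -mulrA ler_pM2l// mulrC ler_pdivrMr ?mulr_gt0//.
  move: lL; rewrite exprS => lL.
  have ln0 : 0 <= ln l by rewrite ln_ge0//; lra.
  have -> : L.+1%:R * 2 ^+ L * (2 * k) = (2 * 2 ^+ L) * (k * L.+1%:R) by ring.
  by rewrite ler_pM// ltW.
- move=> l l2; have [L [Ll lL hln hln2]] := bracket l l2; have l0 : 0 < l by lra.
  apply: (le_trans (upper _ _ _ _ _ _ Ll lL (HX l l0))); rewrite lee_fin.
  have -> : (1 + 2 * C) / k * (l * ln l) = (1 + 2 * C) * (l * ln l) / k by ring.
  rewrite ler_pdivlMr//.
  have h3 : k <= ln l by rewrite ler_ln ?posrE// ltW.
  have e1 : 2 * k <= l * ln l by rewrite ler_pM// ltW.
  have e2 : C * l * (k * L.+1%:R) <= C * l * (2 * ln l)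
    by apply: ler_wpM2l => //; apply: mulr_ge0; exact: ltW.
  lra.
Qed.
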